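(* Let $k\in\mathbb{N}$, $\rho>0$, $M\ge 0$, and let $\mathcal{K}\subset\mathcal{D}_\rho(0)$ be a compact set with $\mathrm{card}(\mathcal{K})>k$. For $g\in\mathcal{U}(k,\rho,\mathcal{K},M)$ write its Taylor series at the origin as $g(z)=\sum_{j=1}^{+\infty}a_jz^j$ (recall $g(0)=0$). Then: 1. If $\rho>1$, there exists a constant $K(k,\rho,\mathcal{K})$, depending only on $k,\rho,\mathcal{K}$, such that for every $g\in\mathcal{U}(k,\rho,\mathcal{K},M)$ and every $j\ge1$, $$|a_j|\le K(k,\rho,\mathcal{K})\,M.$$ 2. If $\rho\le 1$, then for any number $m>1$ there exists a constant $K(k,m,\mathcal{K})$, depending only on $k,m,\mathcal{K}$, such that for every $g\in\mathcal{U}(k,\rho,\mathcal{K},M)$ and every $j\ge1$, $$|a_j|\le K(k,m,\mathcal{K})\,M\left(\frac{m}{\rho}\right)^j.$$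
   Context: $\mathcal{D}_\rho(0)\subset\mathbb{C}$ denotes the open complex disk of radius $\rho$ centered at the origin. For $k\in\mathbb{N}$ and $\rho>0$, $\mathcal{V}(k,\rho)$ is the set of functions $f$ such that: (1) $f$ is holomorphic over $\mathcal{D}_\rho(0)$; (2) there is a non-zero polynomial $S\in\mathbb{C}[z,w]$ of (total) degree at most $k$ such that the graph of $f$ is included in $\mathtt{R}_S:=\{(z,w)\in\mathbb{C}^2: S(z,w)=0\}$, i.e. $S(z,f(z))=0$ for all $z\in\mathcal{D}_\rho(0)$; (3) for this $S$, the set $\mathtt{R}_S\cap(\mathcal{D}_\rho(0)\times\mathbb{C})$ is the union of at most $k$ elements, each of which is either a vertical line of the form $\{(z,w)\in\mathbb{C}^2: z=z_*\}$ or the graph of a holomorphic function over $\mathcal{D}_\rho(0)$, these graphs being pairwise disjoint. $\mathcal{V}_0(k,\rho)$ is the subset of those $g\in\mathcal{V}(k,\rho)$ with $g(0)=0$. For a compact set $\mathcal{K}\subset\mathcal{D}_\rho(0)$ and $M\ge0$, $\mathcal{U}(k,\rho,\mathcal{K},M)$ is the subset of those $g\in\mathcal{V}_0(k,\rho)$ with $\max_{\mathcal{K}}|g|=M$. *)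

(* Defs.v *)
From HB Require Import structures.
From mathcomp Require Import all_boot all_order all_algebra.
From mathcomp Require Import complex.
From mathcomp Require Import all_classical all_reals all_analysis.

Set Implicit Arguments.
Unset Strict Implicit.
Unset Printing Implicit Defensive.

Import Order.TTheory GRing.Theory Num.Theory.
Import numFieldNormedType.Exports.

Local Open Scope classical_set_scope.
Local Open Scope card_scope.
Local Open Scope ring_scope.
Local Open Scope complex_scope.

(* The complex numbers are R[i] for R : realType.  The copy R[i]^o carries the
   normed-module (hence topological) structure over the field R[i].  The norm
   `|z| and the order take place in R[i], so that `|z| < rho%:C is the usual
   inequality between real numbers.
   A function on a disk is represented by a total function R[i]^o -> R[i]^o of
   which only the values on the disk matter. *)

Definition disk (R : realType) (rho : R) : set R[i]^o :=
  [set z | `|z| < rho%:C].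

(* The scalar field of the normed module R[i]^o is R[i], so [derivable f z 1] is
   complex differentiability at z. *)
Definition holomorphic_on_disk (R : realType) (rho : R)
    (f : R[i]^o -> R[i]^o) : Prop :=
  forall z, disk rho z -> derivable f z 1.

Definition graph_on_disk (R : realType) (rho : R)
    (f : R[i]^o -> R[i]^o) : set (R[i]^o * R[i]^o) :=
  [set p | disk rho p.1 /\ p.2 = f p.1].

Definition vertical_line (R : realType) (c : R[i]^o) : set (R[i]^o * R[i]^o) :=
  [set p | p.1 = c].

Definition vertical_lines (R : realType) : set (set (R[i]^o * R[i]^o)) :=
  range (@vertical_line R).

Definition holomorphic_graphs (R : realType) (rho : R) :
    set (set (R[i]^o * R[i]^o)) :=
  [set graph_on_disk rho h | h in holomorphic_on_disk rho].

(* In S : {poly {poly R[i]}} the outer variable is z and the inner one is w: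
   S`_i`_j is the coefficient of z^i w^j and S.[z, w] is the value S(z, w). *)
Definition total_degree_le (R : realType) (k : nat) (S : {poly {poly R[i]}}) :
    Prop :=
  forall i j : nat, S`_i`_j != 0 -> (i + j <= k)%N.

Definition zero_locus (R : realType) (S : {poly {poly R[i]}}) :
    set (R[i]^o * R[i]^o) :=
  [set p | S.[p.1, p.2] = 0].

(* The family F is a set of subsets of C^2: "at most k elements" is its
   cardinality, and two members which are distinct graphs are disjoint. *)
Definition splits_on_disk (R : realType) (k : nat) (rho : R)
    (S : {poly {poly R[i]}}) : Prop :=
  exists F : set (set (R[i]^o * R[i]^o)),
    [/\ F #<= `I_k,
        F `<=` @vertical_lines R `|` holomorphic_graphs rho,
        trivIset (F `&` holomorphic_graphs rho) id &
        zero_locus S `&` (disk rho `*` setT) = \bigcup_(A in F) A].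

Definition classV (R : realType) (k : nat) (rho : R) :
    set (R[i]^o -> R[i]^o) :=
  [set f | holomorphic_on_disk rho f /\
     exists S : {poly {poly R[i]}},
       [/\ S != 0, total_degree_le k S,
           graph_on_disk rho f `<=` zero_locus S &
           splits_on_disk k rho S]].

Definition classV0 (R : realType) (k : nat) (rho : R) :
    set (R[i]^o -> R[i]^o) :=
  [set g | classV k rho g /\ g 0 = 0].

Definition is_max_norm (R : realType) (K : set R[i]^o)
    (g : R[i]^o -> R[i]^o) (M : R) : Prop :=
  (forall z, K z -> `|g z| <= M%:C) /\ (exists2 z, K z & `|g z| = M%:C).

Definition classU (R : realType) (k : nat) (rho : R) (K : set R[i]^o) (M : R) :
    set (R[i]^o -> R[i]^o) :=
  [set g | classV0 k rho g /\ is_max_norm K g M].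

Definition taylor_coef (R : realType) (g : R[i]^o -> R[i]^o) (j : nat) : R[i] :=
  derive1n j g 0 / j`!%:R.

(* Main.v *)
Require Import Defs.
From HB Require Import structures.
From mathcomp Require Import all_boot all_order all_algebra.
From mathcomp Require Import complex.
From mathcomp Require Import all_classical all_reals all_analysis.
From mathcomp Require Import ring lra.
Set Implicit Arguments.
Unset Strict Implicit.
Unset Printing Implicit Defensive.

Import Order.TTheory GRing.Theory Num.Theory.
Import numFieldNormedType.Exports.
Local Open Scope classical_set_scope.
Local Open Scope card_scope.
Local Open Scope ring_scope.
Local Open Scope complex_scope.

(** Let t bound |g| on k + 1 points of K, and write S(z, w) = sum_j s_j(z) w^j.
   On the graph of g over these points s_0(z) is minus the sum of the other terms,
   so that, by interpolation, the coefficients of s_0 are bounded by a constant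
   times those of the s_j t^j with j >= 1 ([free_part_bound]).

   Among the scales between t and a constant multiple of t there is one, called t
   again, at which the coefficients of a single s_q t^q exceed those of all other
   s_j t^j by a large factor ([dominant_scale], a Newton polygon argument); by the
   previous remark q >= 1.  In the annulus between rho / m and rho there is a
   circle |z| = r on which s_q is comparable with its coefficients
   ([good_circle]).  Over that circle S(z, .) has no root with t <= |w| <= 3 t, but
   it has a root with |w| < t ([no_root_annulus], [small_root]).  The small root
   lies on one of the disjoint graphs, say of h, and by continuity |h| < t on the
   whole circle.

   Likewise |g| < t on the whole circle or |g| > 3 t on the whole circle.  In the
   first case Cauchy's estimate on |z| = r gives the conclusion, because
   1 / r < m / rho.  The second case is impossible: g and h differ at a point,
   hence g - h has no zero ([graphs_agree]), its modulus is at least 2 t on the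
   circle, hence also at 0 by the maximum principle for 1 / (g - h); but g(0) = 0
   and |h(0)| <= t.  The constants only depend on k, m, the k + 1 points and bounds
   for rho ([uniform_estimate]); when rho <= 1 varies, the modulus of a nonzero point
   among the chosen ones is a positive lower bound for it.

   Cauchy's estimate for functions which are merely complex differentiable is
   obtained from primitives instead of contour integrals.  Goursat's bisection
   shows that a function continuous on a disk and differentiable off finitely many
   points has a primitive Phi on smaller disks.  By Rolle's theorem along a circle, if
   Phi' = phi then w phi(w) cannot stay in an open half plane with 0 on its boundary
   while w runs over the circle ([circle_zero]).  Applied to the difference quotient of f
   times a suitable kernel this is the maximum principle, from which difference
   quotients inherit Lipschitz bounds and differentiability, so that f is
   infinitely differentiable; applied to (f(w) / w^n - a_n) / w it is Cauchy's
   estimate. *)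

(** * The modulus as a real number *)

Lemma is_derive_epsP (K : numFieldType) (V : normedModType K) (f : K^o -> V) (x : K) (a : V) :
  is_derive (x : K^o) 1 f a <->
  forall e : K, 0 < e -> exists2 d : K, 0 < d &
    forall h : K, `|h| < d -> `|f (x + h) - f x - h *: a| <= e * `|h|.
Proof.
split=> [[df <-] e e0|H].
  move/cvgrPdist_le : df => /(_ e e0) /nbhs_ballP[d /= d0 Hd].
  exists d => // h hd.
  have [->|h0] := eqVneq h 0.
    by rewrite addr0 subrr scale0r subr0 !normr0 mulr0.
  have := Hd h; rewrite /ball /= sub0r normrN => /(_ hd h0).
  rewrite -[X in _ -> X <= _](_ : `|h| * `|'D_1 f x - h^-1 *: (f (h *: 1 + x) - f x)| = _); last first.
    rewrite -normrZ scalerBr scalerA divff// scale1r -normrN opprB.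
    by rewrite [h *: (1 : K)]mulr1 (addrC h).
  by move=> H; rewrite mulrC ler_wpM2r.
have H1 : (fun h => h^-1 *: (f (h *: (1 : K^o) + x) - f x)) @ 0^' --> a.
  apply/cvgrPdist_le => e e0; have [d d0 Hd] := H e e0.
  apply/nbhs_ballP; exists d => //= h; rewrite /ball /= sub0r normrN => hd h0.
  have := Hd h hd; rewrite -[X in X <= _](_ : `|h| * `|a - h^-1 *: (f (h *: (1 : K^o) + x) - f x)| = _).
    by rewrite (mulrC e) ler_pM2l// normr_gt0.
  rewrite -normrZ scalerBr scalerA divff// scale1r -normrN opprB.
  by rewrite [h *: (1 : K)]mulr1 (addrC h).
split.
  by apply/cvg_ex; exists a.
exact/cvg_lim.
Qed.

Definition cabs (R : realType) (z : R[i]) : R := Normc.normc z.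

Section Modulus.
Variable R : realType.
Implicit Types z w : R[i].

Lemma cabsE z : `|z| = (cabs z)%:C. Proof. by []. Qed.

Lemma cabsoE (z : R[i]^o) : `|z| = (cabs z)%:C. Proof. by []. Qed.

Lemma cabs_ge0 z : 0 <= cabs z.
Proof. by rewrite -lecR -cabsE normr_ge0. Qed.

Lemma cabs0 : cabs (0 : R[i]) = 0. Proof. exact: Normc.normc0. Qed.
Lemma cabs1 : cabs (1 : R[i]) = 1. Proof. exact: Normc.normc1. Qed.

Lemma cabsM z w : cabs (z * w) = cabs z * cabs w.
Proof. exact: Normc.normcM. Qed.

Lemma cabsV z : cabs z^-1 = (cabs z)^-1.
Proof. exact: Normc.normcV. Qed.

Lemma cabsN z : cabs (- z) = cabs z.
Proof. exact: normcN. Qed.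

Lemma cabsBC z w : cabs (z - w) = cabs (w - z).
Proof. by rewrite -cabsN opprB. Qed.

Lemma cabsX z n : cabs (z ^+ n) = cabs z ^+ n.
Proof.
by elim: n => [|n IH]; rewrite ?expr0 ?cabs1// !exprS cabsM IH.
Qed.

Lemma cabs_eq0 z : (cabs z == 0) = (z == 0).
Proof.
apply/eqP/eqP => [|->]; [exact: Normc.eq0_normc|exact: cabs0].
Qed.

Lemma cabs_gt0 z : (0 < cabs z) = (z != 0).
Proof. by rewrite lt_def cabs_eq0 cabs_ge0 andbT. Qed.

Lemma cabsD z w : cabs (z + w) <= cabs z + cabs w.
Proof. exact: le_normcD. Qed.

Lemma cabsB z w : cabs (z - w) <= cabs z + cabs w.
Proof. by rewrite -(cabsN w) cabsD. Qed.

Lemma cabs_sub_ge z w : cabs z - cabs w <= cabs (z - w).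
Proof. by rewrite lerBlDr -{1}(subrK w z) cabsD. Qed.

Lemma cabs_le_sub z w : cabs z <= cabs (z - w) + cabs w.
Proof. by rewrite -{1}(subrK w z) cabsD. Qed.

Lemma cabs_sum I (s : seq I) (P : pred I) (F : I -> R[i]) :
  cabs (\sum_(i <- s | P i) F i) <= \sum_(i <- s | P i) cabs (F i).
Proof.
elim/big_rec2: _ => [|i y x _ IH]; first by rewrite cabs0.
by rewrite (le_trans (cabsD _ _))// lerD2l.
Qed.

Lemma cabsR (x : R) : cabs x%:C = `|x|.
Proof. by rewrite /cabs /= expr0n /= addr0 sqrtr_sqr. Qed.

Lemma cabs_i : cabs ('i : R[i]) = 1.
Proof. by rewrite /cabs /= expr0n /= add0r expr1n sqrtr1. Qed.

Lemma cabs_conj z : cabs z^* = cabs z.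
Proof. by case: z => a b; rewrite /cabs /= sqrrN. Qed.

Lemma cabs_sqr z : cabs z ^+ 2 = complex.Re z ^+ 2 + complex.Im z ^+ 2.
Proof. by case: z => a b; rewrite /cabs /= sqr_sqrtr// addr_ge0// sqr_ge0. Qed.

Lemma Re_le_cabs z : `|complex.Re z| <= cabs z.
Proof. by rewrite -lecR; exact: normc_ge_Re. Qed.

Lemma Im_le_cabs z : `|complex.Im z| <= cabs z.
Proof.
rewrite -(ler_pXn2r (n := 2)) ?nnegrE ?cabs_ge0//.
by rewrite cabs_sqr real_normK ?num_real// lerDr sqr_ge0.
Qed.

Lemma cabs_le_ReIm z : cabs z <= `|complex.Re z| + `|complex.Im z|.
Proof.
rewrite -(ler_pXn2r (n := 2)) ?nnegrE ?cabs_ge0 ?addr_ge0//.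
rewrite cabs_sqr sqrrD !real_normK ?num_real//.
by rewrite addrAC lerDl mulrn_wge0// mulr_ge0.
Qed.

Lemma mul_conj_cabs z : z^* * z = (cabs z ^+ 2)%:C.
Proof.
rewrite cabs_sqr; case: z => a b /=; apply/eqP; rewrite eq_complex /=.
by apply/andP; split; apply/eqP; ring.
Qed.

Lemma cabsC_le z (r : R) : (`|z| <= r%:C) = (cabs z <= r).
Proof. by rewrite cabsE lecR. Qed.

Lemma diskE (r : R) z : disk r z <-> cabs z < r.
Proof. by rewrite /disk /= cabsE ltcR. Qed.

Lemma gt0_complexE (x : R[i]) : 0 < x -> exists2 r : R, 0 < r & x = r%:C.
Proof. by case: x => a b; rewrite ltcE /= => /andP[/eqP -> h]; exists a. Qed.

(** The norm of R[i] takes its values in R[i]; restated with the real modulus,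
   differentiability and continuity are open to real arithmetic. *)
Lemma cderiveP (f : R[i]^o -> R[i]^o) (z a : R[i]^o) :
  is_derive z 1 f a <->
  forall e : R, 0 < e -> exists2 d : R, 0 < d &
    forall h : R[i], cabs h < d ->
      cabs (f (z + h) - f z - a * h) <= e * cabs h.
Proof.
rewrite (@is_derive_epsP R[i] R[i]^o f z a); split=> H e e0.
  have [|d /gt0_complexE[d' d0 ->] Hd] := H e%:C; first by rewrite ltcR.
  exists d' => // h hd.
  have /Hd : `|h| < d'%:C by rewrite cabsE ltcR.
  by rewrite cabsoE cabsE -rmorphM lecR -[h *: a]/(h * a) (mulrC h).
have [e' e'0 ->] := gt0_complexE e0.
have [d d0 Hd] := H e' e'0.
exists d%:C; first by rewrite ltcR.
move=> h; rewrite cabsE ltcR => /Hd.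
by rewrite !cabsoE -rmorphM lecR -[h *: a]/(h * a) (mulrC h).
Qed.

Lemma ccontinuousP (f : R[i]^o -> R[i]^o) (z : R[i]^o) :
  {for z, continuous f} <->
  forall e : R, 0 < e -> exists2 d : R, 0 < d &
    forall w : R[i], cabs (w - z) < d -> cabs (f w - f z) < e.
Proof.
split=> [H e e0|H].
  move/cvgrPdist_lt : H => /(_ e%:C); rewrite ltcR => /(_ e0).
  move=> /nbhs_ballP[d /= /gt0_complexE[d' d0 ->] Hd].
  exists d' => // w wd; have := Hd w.
  rewrite /ball /= cabsE cabsBC ltcR => /(_ wd).
  by rewrite cabsE ltcR cabsBC.
apply: (@cvgrPdist_lt _ R[i]^o _ (nbhs z) (nbhs_filter z) f (f z)).2.
move=> e /gt0_complexE[e' e0 ->].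
have [d d0 Hd] := H e' e0.
apply/nbhs_ballP; exists d%:C; first by rewrite /= ltcR.
move=> w; rewrite /ball /= cabsE ltcR cabsBC => /Hd.
by rewrite cabsE ltcR cabsBC.
Qed.

(** R[i]^o is a normed module over R[i], not over R, so that [is_derive] does not
   cover complex-valued functions of a real variable. *)
Definition rderive (phi : R -> R[i]) (t : R) (v : R[i]) : Prop :=
  forall e : R, 0 < e -> exists2 d : R, 0 < d &
    forall h : R, `|h| < d ->
      cabs (phi (t + h) - phi t - v * h%:C) <= e * `|h|.

Lemma rderiveP (f : R -> R) (t v : R) :
  is_derive t 1 f v <->
  forall e : R, 0 < e -> exists2 d : R, 0 < d &
    forall h : R, `|h| < d -> `|f (t + h) - f t - v * h| <= e * `|h|.
Proof.
rewrite (@is_derive_epsP R R^o f t v); split=> H e e0;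
have [d d0 Hd] := H e e0; exists d => // h /Hd;
by rewrite -[h *: v]/(h * v) (mulrC h).
Qed.

Lemma Re_mulr_real (z : R[i]) (x : R) : complex.Re (z * x%:C) = complex.Re z * x.
Proof. by case: z => a b /=; rewrite mulr0 subr0. Qed.

Lemma rderive_Re (c : R[i]) phi t v : rderive phi t v ->
  is_derive t 1 (fun s => complex.Re (c * phi s)) (complex.Re (c * v)).
Proof.
move=> H; apply/rderiveP => e e0.
have e'0 : 0 < e / (cabs c + 1) by rewrite divr_gt0// ltr_wpDl ?cabs_ge0.
have [d d0 Hd] := H _ e'0; exists d => // h /Hd le1.
rewrite -Re_mulr_real -!raddfB (le_trans (Re_le_cabs _))//.
rewrite -mulrA -!mulrBr cabsM.
have c1 : 0 < cabs c + 1 by rewrite ltr_wpDl ?cabs_ge0.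
rewrite (le_trans (ler_wpM2l (cabs_ge0 c) le1))//.
rewrite mulrA ler_wpM2r// mulrCA ler_piMr ?(ltW e0)//.
by rewrite ler_pdivrMr// mul1r lerDl.
Qed.

Lemma rderive_parts (u w : R -> R) (t u' w' : R) :
  is_derive t 1 u u' -> is_derive t 1 w w' ->
  rderive (fun s => u s +i* w s) t (u' +i* w').
Proof.
move=> /rderiveP Hu /rderiveP Hw e e0.
have e2 : 0 < e / 2 by rewrite divr_gt0.
have [d1 d10 H1] := Hu _ e2; have [d2 d20 H2] := Hw _ e2.
exists (Num.min d1 d2); first by rewrite lt_min d10.
move=> h; rewrite lt_min => /andP[/H1 h1 /H2 h2].
rewrite (le_trans (cabs_le_ReIm _))//= !mulr0 !(subr0, addr0, add0r).
by rewrite [in leRHS](splitr e) mulrDl lerD.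
Qed.

Lemma rderive_comp (F : R[i]^o -> R[i]^o) gam t (a v : R[i]) :
  is_derive (gam t : R[i]^o) 1 F a -> rderive gam t v ->
  rderive (fun s => F (gam s)) t (a * v).
Proof.
move=> /cderiveP HF Hg e e0.
pose V := cabs v + 1; pose A := cabs a + 1.
have V0 : 0 < V by rewrite ltr_wpDl ?cabs_ge0.
have A0 : 0 < A by rewrite ltr_wpDl ?cabs_ge0.
have e1 : 0 < e / 2 / V by rewrite !divr_gt0.
have [d1 d10 H1] := HF _ e1.
have e2 : 0 < Num.min 1 (e / 2 / A) by rewrite lt_min ltr01 !divr_gt0.
have [d2 d20 H2] := Hg _ e2.
exists (Num.min d2 (d1 / V)); first by rewrite lt_min d20 divr_gt0.
move=> h; rewrite lt_min => /andP[/H2 h2 hd].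
set k := gam (t + h) - gam t.
have kE : gam (t + h) = gam t + k by rewrite /k [RHS]addrC subrK.
have h3 : cabs (k - v * h%:C) <= 1 * `|h|.
  by rewrite (le_trans h2)// ler_wpM2r// ge_min lexx.
have h4 : cabs (k - v * h%:C) <= e / 2 / A * `|h|.
  by rewrite (le_trans h2)// ler_wpM2r// ge_min lexx orbT.
have kV : cabs k <= V * `|h|.
  rewrite (le_trans (cabs_le_sub k (v * h%:C)))//.
  rewrite [cabs (v * _)]cabsM cabsR /V mulrDl addrC lerD2l.
  by rewrite (le_trans h3).
have kd : cabs k < d1.
  by rewrite (le_lt_trans kV)// mulrC -ltr_pdivlMr.
have := H1 k kd; rewrite -kE => h5.
rewrite (_ : _ - _ - _ = F (gam (t + h)) - F (gam t) - a * k + a * (k - v * h%:C)); last by ring.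
rewrite (le_trans (cabsD _ _))// [in leRHS](splitr e) mulrDl lerD//.
  rewrite (le_trans h5)//.
  rewrite -!mulrA ler_wpM2l ?(ltW e0)// ler_wpM2l// ?invr_ge0//.
  by rewrite mulrC ler_pdivrMr// mulrC.
rewrite cabsM (le_trans (ler_wpM2l (cabs_ge0 _) h4))//.
rewrite mulrA ler_wpM2r// mulrCA ler_piMr ?divr_ge0 ?(ltW e0)//.
by rewrite ler_pdivrMr// mul1r lerDl.
Qed.

Lemma rderiveB phi psi t v w : rderive phi t v -> rderive psi t w ->
  rderive (fun s => phi s - psi s) t (v - w).
Proof.
move=> Hp Hq e e0.
have e2 : 0 < e / 2 by rewrite divr_gt0.
have [d1 d10 H1] := Hp _ e2; have [d2 d20 H2] := Hq _ e2.
exists (Num.min d1 d2); first by rewrite lt_min d10.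
move=> h; rewrite lt_min => /andP[/H1 h1 /H2 h2].
rewrite (_ : _ - _ - _ = (phi (t + h) - phi t - v * h%:C) -
  (psi (t + h) - psi t - w * h%:C)); last by ring.
by rewrite (le_trans (cabsB _ _))// [in leRHS](splitr e) mulrDl lerD.
Qed.

Lemma rderive_affine (p v : R[i]) t : rderive (fun s => p + v * s%:C) t v.
Proof.
move=> e e0; exists 1 => // h _.
rewrite (_ : _ - _ - _ = 0) ?cabs0 ?mulr_ge0 ?(ltW e0)//.
by rewrite rmorphD; ring.
Qed.

(** Mean value theorem for a real-linear functional of a path; applied with c
   the conjugate of the increment it gives the mean value inequality, and on a
   closed path it is Rolle's theorem. *)
Lemma rderive_MVT (c : R[i]) phi phi' (a b : R) : a <= b ->
  (forall t, a <= t <= b -> rderive phi t (phi' t)) ->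
  exists2 t, a <= t <= b &
    complex.Re (c * (phi b - phi a)) = complex.Re (c * phi' t) * (b - a).
Proof.
move=> ab H; pose f s := complex.Re (c * phi s).
have Hf t : a <= t <= b -> is_derive t 1 f (complex.Re (c * phi' t)).
  by move=> tab; exact: rderive_Re (H t tab).
have fc : {within `[a, b], continuous f}.
  by apply: derivable_within_continuous => x; rewrite in_itv /= => /Hf[].
have [x|t tab E] := @MVT_segment R f (fun t => complex.Re (c * phi' t)) a b ab _ fc.
  by rewrite in_itv /= => /andP[/ltW ax /ltW xb]; apply: Hf; rewrite ax.
by exists t; [move: tab; rewrite in_itv|rewrite -E mulrBr raddfB].
Qed.

Lemma mean_value_le phi phi' (a b C : R) : a <= b ->
  (forall t, a <= t <= b -> rderive phi t (phi' t)) ->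
  (forall t, a <= t <= b -> cabs (phi' t) <= C) ->
  cabs (phi b - phi a) <= C * (b - a).
Proof.
move=> ab H HC; set D := phi b - phi a.
have [->|D0] := eqVneq D 0.
  rewrite cabs0 mulr_ge0 ?subr_ge0//.
  by rewrite (le_trans _ (HC a _)) ?cabs_ge0// lexx.
have [t tab] := rderive_MVT D^* ab H.
rewrite -/D mul_conj_cabs /= => E.
have D1 : 0 < cabs D by rewrite cabs_gt0.
rewrite -(ler_pM2l D1) -expr2 E mulrA ler_wpM2r ?subr_ge0//.
rewrite (le_trans (ler_norm _))// (le_trans (Re_le_cabs _))// cabsM cabs_conj.
by rewrite ler_pM2l// HC.
Qed.

End Modulus.

(** * Primitives: Goursat's theorem *)

Section Goursat.
Variable R : realType.
Implicit Types z w : R[i].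

Lemma cabs_le_comp z w : `|complex.Re z| <= `|complex.Re w| ->
  `|complex.Im z| <= `|complex.Im w| -> cabs z <= cabs w.
Proof.
move=> h1 h2; rewrite -(ler_pXn2r (n := 2)) ?nnegrE ?cabs_ge0// !cabs_sqr.
rewrite -(real_normK (num_real (complex.Re z))) -(real_normK (num_real (complex.Im z))).
rewrite -(real_normK (num_real (complex.Re w))) -(real_normK (num_real (complex.Im w))).
by rewrite lerD// ler_pXn2r ?nnegrE.
Qed.

Lemma exists_primitive (g : R -> R) (P : R) : 0 < P -> continuous g ->
  exists G : R -> R, forall x : R, `|x| < P -> is_derive x 1 G (g x).
Proof.
move=> P0 gc.
exists (fun x => \int[lebesgue_measure]_(t in [set` `[- P, x]%R]) g t)%R => x.
rewrite ltr_norml => /andP[Px xP].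
have gi : (@lebesgue_measure R).-integrable [set` `[- P, P]%R] (EFin \o g).
  apply: continuous_compact_integrable; first exact: segment_compact.
  exact: continuous_subspaceT.
have [d1 d2] := continuous_FTC1_closed xP gi Px (gc x).
split; first exact: d1.
by rewrite -derive1E; exact: d2.
Qed.

Lemma continuous_epsP (g : R -> R) (x : R) :
  (forall e : R, 0 < e -> exists2 d : R, 0 < d &
    forall y, `|y - x| < d -> `|g y - g x| < e) -> {for x, continuous g}.
Proof.
move=> H; apply/cvgrPdist_lt => e e0; have [d d0 Hd] := H e e0.
apply/nbhs_ballP; exists d => // y; rewrite /ball /= distrC => /Hd.
by rewrite distrC.
Qed.

Lemma exists_cprimitive (g : R -> R[i]) (P : R) : 0 < P ->
  (forall x (e : R), 0 < e -> exists2 d : R, 0 < d &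
    forall y, `|y - x| < d -> cabs (g y - g x) < e) ->
  exists G : R -> R[i], forall x : R, `|x| < P -> rderive G x (g x).
Proof.
move=> P0 gc.
have [x|G1 H1] := @exists_primitive (fun x => complex.Re (g x)) P P0.
  apply: continuous_epsP => e e0; have [d d0 Hd] := gc x e e0.
  exists d => // y /Hd; apply: le_lt_trans.
  by rewrite -raddfB Re_le_cabs.
have [x|G2 H2] := @exists_primitive (fun x => complex.Im (g x)) P P0.
  apply: continuous_epsP => e e0; have [d d0 Hd] := gc x e e0.
  exists d => // y /Hd; apply: le_lt_trans.
  by rewrite -raddfB Im_le_cabs.
exists (fun x => G1 x +i* G2 x) => x xP.
have := rderive_parts (H1 x xP) (H2 x xP).
by case: (g x).
Qed.

Definition between (a b x : R) : Prop := Num.min a b <= x <= Num.max a b.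

Lemma betweenC a b x : between a b x -> between b a x.
Proof. by rewrite /between minC maxC. Qed.

Lemma betweenE a b x : a <= b -> between a b x <-> a <= x <= b.
Proof. by rewrite /between => ab; rewrite min_l// max_r. Qed.

Lemma between_l a b : between a b a.
Proof. by rewrite /between ge_min le_max lexx. Qed.

Lemma between_r a b : between a b b.
Proof. by rewrite /between ge_min le_max lexx !orbT. Qed.

Lemma between_sub a b x y (z : R) : between a b x -> between a b y ->
  between x y z -> between a b z.
Proof.
rewrite /between => /andP[h1 h2] /andP[h3 h4] /andP[h5 h6]; apply/andP; split.
  by rewrite (le_trans _ h5)// le_min h1.
by rewrite (le_trans h6)// ge_max h2.
Qed.

Lemma between_dist a b x : between a b x -> `|x - a| <= `|b - a|.
Proof.
have [ab|/ltW ba] := leP a b; [|move=> /betweenC];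
  move=> /betweenE => /(_ (ltac:(done))) /andP[h1 h2];
  rewrite ler_norml; [rewrite ger0_norm|rewrite ler0_norm]; lra.
Qed.

Lemma between_norm a b x P : `|a| < P -> `|b| < P -> between a b x -> `|x| < P.
Proof.
rewrite !ltr_norml /between => /andP[a1 a2] /andP[b1 b2] /andP[x1 x2].
apply/andP; split.
  by rewrite (lt_le_trans _ x1)// lt_min a1.
by rewrite (le_lt_trans x2)// gt_max a2.
Qed.

Lemma between_partway (s u v : R) : 0 < s < 1 -> u != v ->
  between u v (u + s * (v - u)) /\ ~ between (u + s * (v - u)) v u.
Proof.
rewrite /between => /andP[s0 s1]; case: (ltgtP u v) => // uv _.
  have d0 : 0 < s * (v - u) by rewrite mulr_gt0 ?subr_gt0.
  have d1 : s * (v - u) < v - u by rewrite gtr_pMl ?subr_gt0.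
  split; first by apply/andP; split; lra.
  by rewrite ge_min => /andP[/orP[] ? _]; lra.
have d0 : 0 < s * (u - v) by rewrite mulr_gt0 ?subr_gt0.
have d1 : s * (u - v) < u - v by rewrite gtr_pMl ?subr_gt0.
split; first by apply/andP; split; lra.
by rewrite le_max => /andP[_ /orP[] ?]; lra.
Qed.

Lemma mean_value_between phi phi' (a b C : R) :
  (forall t, between a b t -> rderive phi t (phi' t)) ->
  (forall t, between a b t -> cabs (phi' t) <= C) ->
  cabs (phi b - phi a) <= C * `|b - a|.
Proof.
have [ab|/ltW ba] := leP a b => H1 H2.
  rewrite ger0_norm ?subr_ge0//; apply: (mean_value_le ab) => t tab.
    by apply: H1; apply/betweenE.
  by apply: H2; apply/betweenE.
rewrite cabsBC distrC ger0_norm ?subr_ge0//; apply: (mean_value_le ba) => t tab.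
  by apply: H1; apply: betweenC; apply/betweenE.
by apply: H2; apply: betweenC; apply/betweenE.
Qed.

Lemma rderive_hpath (c t : R) : rderive (fun s => s +i* c) t 1.
Proof.
have := @rderive_parts R id (cst c) t 1 0 (is_derive_id _ _) (is_derive_cst _ _ _).
exact.
Qed.

Lemma rderive_vpath (c t : R) : rderive (fun s => c +i* s) t 'i.
Proof.
have := @rderive_parts R (cst c) id t 0 1 (is_derive_cst _ _ _) (is_derive_id _ _).
exact.
Qed.

Lemma nested_intervals (u v : nat -> R) :
  (forall n, u n <= u n.+1) -> (forall n, v n.+1 <= v n) ->
  (forall n, u n <= v n) -> exists x, forall n, u n <= x <= v n.
Proof.
move=> Hu Hv Huv.
have mu m n : (m <= n)%N -> u m <= u n by move=> mn; exact: ((nondecreasing_seqP u).1 Hu m n mn).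
have mv m n : (m <= n)%N -> v n <= v m by move=> mn; exact: ((nonincreasing_seqP v).1 Hv m n mn).
have uv m n : u m <= v n.
  rewrite (le_trans (mu m (maxn m n) (leq_maxl _ _)))//.
  by rewrite (le_trans (Huv _))// mv// leq_maxr.
exists (sup (range u)) => n; apply/andP; split.
  by apply: ub_le_sup; [exists (v 0%N) => _ [m _ <-]; exact: uv|exists n].
apply: ge_sup; first by exists (u 0%N); exists 0%N.
by move=> _ [m _ <-]; exact: uv.
Qed.

Variables (f : R[i]^o -> R[i]^o) (P : R) (H V : R -> R -> R[i]).
Hypothesis HH : forall x y, `|x| < P -> `|y| < P -> rderive (H y) x (f (x +i* y)).
Hypothesis HV : forall x y, `|x| < P -> `|y| < P -> rderive (V x) y ('i * f (x +i* y)).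

(** The integral of f along the boundary of the rectangle with opposite corners
   a + ic and b + id, written with primitives along horizontal and vertical
   lines; the sides may be traversed backwards, so that no order between a and b
   or c and d is required. *)
Definition rect_integral (a b c d : R) : R[i] :=
  (H c b - H c a) + (V b d - V b c) - (H d b - H d a) - (V a d - V a c).

Local Notation RI := rect_integral.
Local Notation inside := (fun x : R => `|x| < P).

(** The primitive L of l may be subtracted from H and V, since its increments along
   the four sides add up to 0. *)
Lemma rect_integral_le a b c d C (L l : R[i]^o -> R[i]^o) :
  inside a -> inside b -> inside c -> inside d ->
  (forall x y, between a b x -> between c d y ->
    is_derive (x +i* y : R[i]^o) 1 L (l (x +i* y)) /\
    cabs (f (x +i* y) - l (x +i* y)) <= C) ->
  cabs (RI a b c d) <= C * 2 * (`|b - a| + `|d - c|).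
Proof.
move=> ia ib ic id_ Hl.
have hor y : between c d y ->
    cabs ((H y b - L (b +i* y)) - (H y a - L (a +i* y))) <= C * `|b - a|.
  move=> yb; pose phi' s := f (s +i* y) - l (s +i* y).
  apply: (@mean_value_between (fun s => H y s - L (s +i* y)) phi') => t tb.
    apply: rderiveB; first by apply: HH; [exact: between_norm tb|exact: between_norm yb].
    rewrite -[l _]mulr1; apply: rderive_comp; last exact: rderive_hpath.
    by have [] := Hl t y tb yb.
  by have [] := Hl t y tb yb.
have ver x : between a b x ->
    cabs ((V x d - L (x +i* d)) - (V x c - L (x +i* c))) <= C * `|d - c|.
  move=> xb; pose phi' s := 'i * f (x +i* s) - l (x +i* s) * 'i.
  apply: (@mean_value_between (fun s => V x s - L (x +i* s)) phi') => t tb.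
    apply: rderiveB; first by apply: HV; [exact: between_norm xb|exact: between_norm tb].
    apply: rderive_comp; last exact: rderive_vpath.
    by have [] := Hl x t xb tb.
  have [_] := Hl x t xb tb.
  by rewrite /phi' mulrC -mulrBl cabsM cabs_i mulr1.
have h1 := hor c (between_l _ _); have h2 := hor d (between_r _ _).
have v1 := ver a (between_l _ _); have v2 := ver b (between_r _ _).
rewrite (_ : RI a b c d =
  ((H c b - L (b +i* c)) - (H c a - L (a +i* c))) +
  ((V b d - L (b +i* d)) - (V b c - L (b +i* c))) -
  ((H d b - L (b +i* d)) - (H d a - L (a +i* d))) -
  ((V a d - L (a +i* d)) - (V a c - L (a +i* c)))); last first.
  by rewrite /rect_integral; ring.
rewrite (le_trans (cabsB _ _))//.
have := cabsB (((H c b - L (b +i* c)) - (H c a - L (a +i* c))) +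
  ((V b d - L (b +i* d)) - (V b c - L (b +i* c)))) ((H d b - L (b +i* d)) - (H d a - L (a +i* d))).
have := cabsD ((H c b - L (b +i* c)) - (H c a - L (a +i* c)))
  ((V b d - L (b +i* d)) - (V b c - L (b +i* c))).
move: h1 h2 v1 v2; lra.
Qed.

Lemma rect_integral_split a b c d m k :
  RI a b c d = RI a m c k + RI m b c k + RI a m k d + RI m b k d.
Proof. by rewrite /rect_integral; ring. Qed.

Lemma cderive_quad (p q z0 z : R[i]) :
  is_derive (z : R[i]^o) 1 (fun w : R[i]^o => p * w + q * (w - z0) ^+ 2 : R[i]^o)
    (p + q * (z - z0) * 2).
Proof.
apply/cderiveP => e e0; have q0 : 0 < cabs q + 1 by rewrite ltr_wpDl ?cabs_ge0.
exists (e / (cabs q + 1)); first by rewrite divr_gt0.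
move=> h hd; rewrite (_ : _ - _ - _ = q * h * h); last by ring.
rewrite !cabsM ler_wpM2r ?cabs_ge0//.
move: hd; rewrite ltr_pdivlMr// => /ltW; apply: le_trans.
by rewrite mulrC ler_wpM2l ?cabs_ge0// lerDl.
Qed.

(** Goursat's bisection.  Near the limit of the bisected rectangles f is affine up to
   an error small compared with their diameter, and affine functions have
   primitives. *)
Lemma goursat_rect a b c d : a < b -> c < d ->
  inside a -> inside b -> inside c -> inside d ->
  (forall x y, a <= x <= b -> c <= y <= d -> derivable f (x +i* y) 1) ->
  RI a b c d = 0.
Proof.
move=> ab cd ia ib ic id_ df; apply/eqP; rewrite -cabs_eq0; apply/negPn/negP => RI0.
pose w n := (b - a) / 2 ^+ n; pose h n := (d - c) / 2 ^+ n.
have w0 n : 0 < w n by rewrite divr_gt0 ?subr_gt0 ?exprn_gt0.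
have h0 n : 0 < h n by rewrite divr_gt0 ?subr_gt0 ?exprn_gt0.
have wS n : w n = w n.+1 + w n.+1.
  by rewrite /w exprS; field; rewrite gt_eqF ?exprn_gt0.
have hS n : h n = h n.+1 + h n.+1.
  by rewrite /h exprS; field; rewrite gt_eqF ?exprn_gt0.
pose kap := cabs (RI a b c d) / ((b - a) * (d - c)).
have kap0 : 0 < kap.
  by rewrite divr_gt0 ?mulr_gt0 ?subr_gt0// lt_def RI0 cabs_ge0.
(* Failure of the conclusion, measured relatively to the area, passes to a
   quarter of the rectangle. *)
pose bad n (p : R * R) :=
  kap * (w n * h n) <= cabs (RI p.1 (p.1 + w n) p.2 (p.2 + h n)).
have [g Hg] : exists g : nat * (R * R) -> R * R, forall q, bad q.1 q.2 ->
    [/\ bad q.1.+1 (g q), q.2.1 <= (g q).1, (g q).1 + w q.1.+1 <= q.2.1 + w q.1,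
        q.2.2 <= (g q).2 & (g q).2 + h q.1.+1 <= q.2.2 + h q.1].
  have : forall q : nat * (R * R), exists p, bad q.1 q.2 ->
      [/\ bad q.1.+1 p, q.2.1 <= p.1, p.1 + w q.1.+1 <= q.2.1 + w q.1,
        q.2.2 <= p.2 & p.2 + h q.1.+1 <= q.2.2 + h q.1].
    move=> [n [x y]] /=.
    have [Hb|nHb] := pselect (bad n (x, y)); last by exists (x, y).
    have wn := w0 n.+1; have hn := h0 n.+1; have wE := wS n; have hE := hS n.
    suff [p Hp] : exists2 p, bad n.+1 p &
        (p.1 = x \/ p.1 = x + w n.+1) /\ (p.2 = y \/ p.2 = y + h n.+1).
      case=> h1 h2; exists p => _; split => //; move: h1 h2 wn hn wE hE; clear => h1 h2 *;
        first [case: h1 => -> | case: h2 => ->]; lra.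
    apply: contrapT => /forall2NP nb.
    have lt p1 p2 : p1 = x \/ p1 = x + w n.+1 -> p2 = y \/ p2 = y + h n.+1 ->
        cabs (RI p1 (p1 + w n.+1) p2 (p2 + h n.+1)) < kap * (w n.+1 * h n.+1).
      by move=> h1 h2; have [/negP|[]//] := nb (p1, p2); rewrite -ltNge.
    have l1 := lt x y (or_introl erefl) (or_introl erefl).
    have l2 := lt (x + w n.+1) y (or_intror erefl) (or_introl erefl).
    have l3 := lt x (y + h n.+1) (or_introl erefl) (or_intror erefl).
    have l4 := lt (x + w n.+1) (y + h n.+1) (or_intror erefl) (or_intror erefl).
    move: Hb; rewrite /bad /= (rect_integral_split _ _ _ _ (x + w n.+1) (y + h n.+1)).
    rewrite wE hE !(addrA x) !(addrA y).
    set A := RI _ _ _ _ in l1 *; set B := RI _ _ _ _ in l2 *.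
    set C := RI _ _ _ _ in l3 *; set D := RI _ _ _ _ in l4 *.
    have := cabsD (A + B + C) D; have := cabsD (A + B) C; have := cabsD A B.
    move: l1 l2 l3 l4; rewrite !mulrDl !mulrDr; lra.
  by case/choice => g Hg; exists g.
pose fix s n := if n is m.+1 then g (m, s m) else (a, c).
have sbad n : bad n (s n).
  elim: n => [|n IH] /=; last by case: (Hg (n, s n) IH).
  rewrite /bad /= /w /h expr0 !divr1 /kap divfK ?subrKC//.
  by rewrite mulf_neq0// gt_eqF ?subr_gt0.
have sP n := Hg (n, s n) (sbad n).
have [x Hx] : exists x, forall n, (s n).1 <= x <= (s n).1 + w n.
  apply: nested_intervals => n; try by case: (sP n).
  by rewrite lerDl ltW.
have [y Hy] : exists y, forall n, (s n).2 <= y <= (s n).2 + h n.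
  apply: nested_intervals => n; try by case: (sP n).
  by rewrite lerDl ltW.
have sin n : [/\ a <= (s n).1, (s n).1 + w n <= b, c <= (s n).2 & (s n).2 + h n <= d].
  elim: n => [|n [i1 i2 i3 i4]]; first by rewrite /= /w /h expr0 !divr1 !subrKC.
  by case: (sP n) => _ j1 j2 j3 j4; split;
    [exact: le_trans i1 j1|exact: le_trans j2 i2|exact: le_trans i3 j3|exact: le_trans j4 i4].
have xab : a <= x <= b.
  have [i1 i2 _ _] := sin 0%N; have /andP[j1 j2] := Hx 0%N.
  by rewrite (le_trans i1 j1) (le_trans j2 i2).
have ycd : c <= y <= d.
  have [_ _ i1 i2] := sin 0%N; have /andP[j1 j2] := Hy 0%N.
  by rewrite (le_trans i1 j1) (le_trans j2 i2).
pose z0 := x +i* y : R[i].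
have /derivableP/cderiveP Hd := df x y xab ycd.
set f' := 'D_1 f _ in Hd.
pose S := (b - a) + (d - c).
have S0 : 0 < S by rewrite addr_gt0 ?subr_gt0.
pose e := kap * ((b - a) * (d - c)) / (4 * S ^+ 2).
have e0 : 0 < e.
  apply: divr_gt0; last by rewrite mulr_gt0 ?exprn_gt0.
  by apply: mulr_gt0 => //; rewrite mulr_gt0 ?subr_gt0.
have [del del0 Hdel] := Hd e e0.
have [n Hn] : exists n, S / del < 2 ^+ n.
  by exists (Num.bound (S / del)); exact: Num.Theory.upper_nthrootP.
have p2 : 0 < 2 ^+ n :> R by rewrite exprn_gt0.
have Sn : w n + h n = S / 2 ^+ n by rewrite -mulrDl.
have Sdel : w n + h n < del.
  by rewrite Sn ltr_pdivrMr// mulrC -ltr_pdivrMr.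
have [i1 i2 i3 i4] := sin n.
have wn := w0 n; have hn := h0 n.
have bnd : cabs (RI (s n).1 ((s n).1 + w n) (s n).2 ((s n).2 + h n)) <=
    (e * (w n + h n)) * 2 * (`|(s n).1 + w n - (s n).1| + `|(s n).2 + h n - (s n).2|).
  apply: (rect_integral_le (L := fun w : R[i]^o => f z0 * w + f' / 2 * (w - z0) ^+ 2)
     (l := fun w => f z0 + f' / 2 * (w - z0) * 2)).
  - by apply: between_norm ia ib _; apply/(betweenE _ (ltW ab)); rewrite i1 (le_trans _ i2)// lerDl ltW.
  - by apply: between_norm ia ib _; apply/(betweenE _ (ltW ab)); rewrite i2 (le_trans i1)// lerDl ltW.
  - by apply: between_norm ic id_ _; apply/(betweenE _ (ltW cd)); rewrite i3 (le_trans _ i4)// lerDl ltW.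
  - by apply: between_norm ic id_ _; apply/(betweenE _ (ltW cd)); rewrite i4 (le_trans i3)// lerDl ltW.
  have wle : (s n).1 <= (s n).1 + w n by rewrite lerDl ltW.
  have hle : (s n).2 <= (s n).2 + h n by rewrite lerDl ltW.
  move=> x' y' /(betweenE _ wle) hx' /(betweenE _ hle) hy'.
  split; first exact: cderive_quad.
  pose k := (x' +i* y' : R[i]) - z0.
  have kS : cabs k <= w n + h n.
    rewrite (le_trans (cabs_le_ReIm _))//= lerD// ler_norml;
    move: (Hx n) (Hy n) hx' hy' wn hn; clear => /andP[? ?] /andP[? ?] /andP[? ?] /andP[? ?] ? ?; lra.
  have := Hdel k (le_lt_trans kS Sdel).
  rewrite (_ : z0 + k = x' +i* y'); last by rewrite /k addrC subrK.
  rewrite (_ : _ - _ - _ = f (x' +i* y') - (f z0 + f' / 2 * k * 2)); last first.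
    by rewrite -/z0; field.
  move=> /le_trans; apply.
  by rewrite ler_wpM2l// ltW.
have := sbad n; rewrite /bad => /le_trans /(_ bnd).
rewrite !(addrC (s n).1) !(addrC (s n).2) !addrK (ger0_norm (ltW wn)) (ger0_norm (ltW hn)) Sn.
rewrite leNgt => /negP; apply.
rewrite (_ : kap * _ = e * 4 * (S / 2 ^+ n) ^+ 2); last first.
  rewrite /e /w /h; field.
  by rewrite gt_eqF// gt_eqF.
have T0 : 0 < S / 2 ^+ n by rewrite divr_gt0.
move: (S / 2 ^+ n) T0 => T T0.
by have := mulr_gt0 (mulr_gt0 e0 T0) T0; clear; lra.
Qed.

Lemma rect_integralC a b c d : RI b a c d = - RI a b c d.
Proof. by rewrite /rect_integral; ring. Qed.

Lemma rect_integralCv a b c d : RI a b d c = - RI a b c d.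
Proof. by rewrite /rect_integral; ring. Qed.

Hypothesis fc : forall z, {for z, continuous f}.

Let goursat_nil a b c d :
  inside a -> inside b -> inside c -> inside d ->
  (forall x y, between a b x -> between c d y -> derivable f (x +i* y) 1) ->
  RI a b c d = 0.
Proof.
move=> ia ib ic id_ df.
wlog ab : a b ia ib df / a < b.
  move=> W; have [ab|ba|->] := ltgtP a b; first exact: W.
    rewrite rect_integralC (W b a) ?oppr0// => x y /betweenC xb; exact: df.
  by rewrite /rect_integral; ring.
wlog cd : c d ic id_ df / c < d.
  move=> W; have [cd|dc|->] := ltgtP c d; first exact: W.
    rewrite rect_integralCv (W d c) ?oppr0// => x y xb /betweenC yb; exact: df.
  by rewrite /rect_integral; ring.
apply: goursat_rect => // x y xab ycd; apply: df; apply/betweenE => //; exact: ltW.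
Qed.

(** Points at which f is only continuous do no harm: cutting the rectangle
   through such a point makes it a corner, and a small square at the corner
   contributes an arbitrarily small integral. *)
Lemma goursat (E : seq R[i]) a b c d :
  inside a -> inside b -> inside c -> inside d ->
  (forall x y, between a b x -> between c d y -> x +i* y \notin E ->
     derivable f (x +i* y) 1) ->
  RI a b c d = 0.
Proof.
elim: E a b c d => [|[x0 y0] E IH] a b c d ia ib ic id_ df.
  by apply: goursat_nil => // x y xb yb; exact: df.
have [[xb yb]|out] := pselect (between a b x0 /\ between c d y0); last first.
  apply: IH => // x y xab ycd zE; apply: df => //.
  rewrite inE negb_or zE andbT; apply/eqP => -[xE yE].
  by apply: out; rewrite -xE -yE.
have ix : inside x0 by exact: between_norm xb.
have iy : inside y0 by exact: between_norm yb.
suff corner b' d' : between a b b' -> between c d d' -> inside b' -> inside d' ->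
    RI x0 b' y0 d' = 0.
  rewrite (_ : RI a b c d = RI x0 b y0 d - RI x0 a y0 d - RI x0 b y0 c + RI x0 a y0 c).
    by rewrite !corner ?subrr ?addr0 ?between_l ?between_r//;
      first [exact: between_l|exact: between_r].
  by rewrite /rect_integral; ring.
move=> bb bd ib' id'.
have [->|bx] := eqVneq b' x0; first by rewrite /rect_integral; ring.
have [->|dy] := eqVneq d' y0; first by rewrite /rect_integral; ring.
have [del del0 Hdel] := (ccontinuousP f (x0 +i* y0)).1 (@fc _) 1 ltr01.
pose S := `|b' - x0| + `|d' - y0|.
have S0 : 0 < S by rewrite addr_gt0 ?normr_gt0 ?subr_eq0.
pose C := cabs (f (x0 +i* y0)) + 1.
have C0 : 0 < C by rewrite ltr_wpDl ?cabs_ge0.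
have small s : 0 < s < 1 -> s * S < del -> cabs (RI x0 b' y0 d') <= C * 2 * (s * S).
  move=> s01 sS; have /andP[s0 s1] := s01; pose b2 := x0 + s * (b' - x0); pose d2 := y0 + s * (d' - y0).
  have [b2b b2n] := between_partway s01 (ltac:(by rewrite eq_sym) : x0 != b').
  have [d2b d2n] := between_partway s01 (ltac:(by rewrite eq_sym) : y0 != d').
  have ib2 : inside b2 by exact: between_norm b2b.
  have id2 : inside d2 by exact: between_norm d2b.
  have sub x y : between x0 b' x -> between y0 d' y -> x +i* y \notin E ->
      ~ (x = x0 /\ y = y0) -> derivable f (x +i* y) 1.
    move=> hx hy hE hn; apply: df; [exact: between_sub hx|exact: between_sub hy|].
    by rewrite inE negb_or hE andbT; apply/eqP => -[xE yE]; exact: hn.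
  rewrite (rect_integral_split _ _ _ _ b2 d2).
  rewrite (IH b2 b' y0 d2)//; last first.
    move=> x y hx hy hE; apply: sub => //.
    - exact: between_sub b2b (between_r _ _) hx.
    - exact: between_sub (between_l _ _) d2b hy.
    - by case=> xE _; apply: b2n; move: hx; rewrite xE.
  rewrite (IH x0 b2 d2 d')//; last first.
    move=> x y hx hy hE; apply: sub => //.
    - exact: between_sub (between_l _ _) b2b hx.
    - exact: between_sub d2b (between_r _ _) hy.
    - by case=> _ yE; apply: d2n; move: hy; rewrite yE.
  rewrite (IH b2 b' d2 d')//; last first.
    move=> x y hx hy hE; apply: sub => //.
    - exact: between_sub b2b (between_r _ _) hx.
    - exact: between_sub d2b (between_r _ _) hy.
    - by case=> xE _; apply: b2n; move: hx; rewrite xE.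
  rewrite !addr0.
  have E1 : `|b2 - x0| = s * `|b' - x0|.
    by rewrite /b2 addrC addKr normrM gtr0_norm.
  have E2 : `|d2 - y0| = s * `|d' - y0|.
    by rewrite /d2 addrC addKr normrM gtr0_norm.
  rewrite /S (mulrDr s `|_|) -E1 -E2.
  apply: (rect_integral_le (L := cst 0) (l := cst 0)) => // x y hx hy.
  split; first exact: is_derive_cst.
  have : cabs ((x +i* y : R[i]) - (x0 +i* y0)) < del.
    rewrite (le_lt_trans _ sS)// (le_trans (cabs_le_ReIm _))//= /S (mulrDr s `|_|) -E1 -E2.
    by rewrite lerD// between_dist.
  move=> /Hdel /ltW le1; rewrite [X in cabs X](_ : _ = f (x +i* y)) ?subr0//.
  by rewrite (le_trans (cabs_le_sub _ (f (x0 +i* y0))))// addrC lerD2l.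
apply/eqP; rewrite -cabs_eq0 eq_le cabs_ge0 andbT leNgt; apply/negP => RI0.
pose K := cabs (RI x0 b' y0 d').
have [s [s0 s1 s2 s3]] : exists s, [/\ 0 < s, s < 1, s * S < del & C * 2 * (s * S) < K].
  pose m := Num.min (1 / 2) (Num.min (del / S / 2) (K / (C * 2 * S) / 2)).
  have m0 : 0 < m by rewrite !lt_min !divr_gt0 ?mulr_gt0.
  have [m1 m2 m3] : [/\ m <= 1 / 2, m <= del / S / 2 & m <= K / (C * 2 * S) / 2].
    by rewrite /m; split; rewrite !ge_min lexx ?orbT.
  exists m; split => //; first by lra.
    rewrite -ltr_pdivlMr// (le_lt_trans m2)// ltr_pdivrMr// ltr_pMr ?divr_gt0//; lra.
  rewrite (_ : C * 2 * (m * S) = m * (C * 2 * S)); last by ring.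
  rewrite -ltr_pdivlMr ?mulr_gt0// (le_lt_trans m3)// ltr_pdivrMr// ltr_pMr ?divr_gt0 ?mulr_gt0//; lra.
have := small s; rewrite s0 s1 => /(_ isT s2); rewrite leNgt => /negP; exact.
Qed.

End Goursat.

Section PrimitiveOnDisk.
Variable R : realType.
Implicit Types z w : R[i].

Let primitive_of_continuous (f : R[i]^o -> R[i]^o) (rho : R) (E : seq R[i]) :
  0 < rho -> (forall z, {for z, continuous f}) ->
  (forall z, cabs z < rho -> z \notin E -> derivable f z 1) ->
  exists F : R[i]^o -> R[i]^o,
    forall z, cabs z < rho -> is_derive (z : R[i]^o) 1 F (f z).
Proof.
move=> rho0 fc df.
have fc' z : forall e : R, 0 < e -> exists2 d : R, 0 < d &
    forall w : R[i], cabs (w - z) < d -> cabs (f w - f z) < e.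
  exact: (ccontinuousP f z).1 (fc z).
have [H HH] : {H : R -> R -> R[i] & forall y x, `|x| < rho -> rderive (H y) x (f (x +i* y))}.
  apply: (@choice R (R -> R[i]) (fun y G => forall x, `|x| < rho -> rderive G x (f (x +i* y)))) => y.
  apply: (@exists_cprimitive R (fun x => f (x +i* y))) => // x e e0.
  have [d d0 Hd] := fc' (x +i* y) e e0; exists d => // x' xd.
  apply: Hd; rewrite (le_lt_trans (cabs_le_ReIm _))//=.
  by rewrite subrr normr0 addr0.
have [V HV] : {V : R -> R -> R[i] & forall x y, `|y| < rho -> rderive (V x) y ('i * f (x +i* y))}.
  apply: (@choice R (R -> R[i]) (fun x G => forall y, `|y| < rho -> rderive G y ('i * f (x +i* y)))) => x.
  apply: (@exists_cprimitive R (fun y => 'i * f (x +i* y))) => // y e e0.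
  have [d d0 Hd] := fc' (x +i* y) e e0; exists d => // y' yd.
  rewrite -mulrBr cabsM cabs_i mul1r.
  apply: Hd; rewrite (le_lt_trans (cabs_le_ReIm _))//=.
  by rewrite subrr normr0 add0r.
have HH' x y : `|x| < rho -> `|y| < rho -> rderive (H y) x (f (x +i* y)) by move=> ? _; exact: HH.
have HV' x y : `|x| < rho -> `|y| < rho -> rderive (V x) y ('i * f (x +i* y)) by move=> _ ?; exact: HV.
pose F (z : R[i]^o) : R[i]^o :=
  H 0 (complex.Re z) - H 0 0 + (V (complex.Re z) (complex.Im z) - V (complex.Re z) 0).
have normRI x y : cabs (x +i* y) < rho -> `|x| < rho /\ `|y| < rho.
  move=> h; split; rewrite (le_lt_trans _ h)//; [exact: (Re_le_cabs (x +i* y))|exact: (Im_le_cabs (x +i* y))].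
(* The integral from 0 to z does not depend on which side of the rectangle is
   followed first. *)
have F2 x y : cabs (x +i* y) < rho -> F (x +i* y) = H y x - H y 0 + (V 0 y - V 0 0).
  move=> zr; have [ix iy] := normRI _ _ zr.
  have i0 : `|0 : R| < rho by rewrite normr0.
  have := goursat HH' HV' fc (E := E) i0 ix i0 iy.
  have -> : (rect_integral H V 0 x 0 y = 0) = (F (x +i* y) - (H y x - H y 0 + (V 0 y - V 0 0)) = 0).
    by congr (_ = _); rewrite /rect_integral /F /=; ring.
  move=> Hg; apply/eqP; rewrite -subr_eq0; apply/eqP; apply: Hg => x' y' xb yb zE.
  apply: df => //; rewrite (le_lt_trans _ zr)//; apply: cabs_le_comp => /=.
    by have := between_dist xb; rewrite !subr0.
  by have := between_dist yb; rewrite !subr0.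
exists F => -[x y] zr; apply/cderiveP => e e0.
have e2 : 0 < e / 2 by rewrite divr_gt0.
have [d d0 Hd] := fc' (x +i* y) _ e2.
exists (Num.min d (rho - cabs (x +i* y))); first by rewrite lt_min d0 subr_gt0.
move=> [h1 h2]; rewrite lt_min => /andP[hd hr].
have [ix iy] := normRI _ _ zr.
have inr x' y' : `|x' - x| <= `|h1| -> `|y' - y| <= `|h2| ->
    cabs (x' +i* y') < rho /\ cabs (f (x' +i* y') - f (x +i* y)) < e / 2.
  move=> hx hy.
  have le : cabs ((x' +i* y' : R[i]) - (x +i* y)) <= cabs (h1 +i* h2) by exact: cabs_le_comp.
  split; last by apply: Hd; exact: le_lt_trans hd.
  by have := cabs_le_sub (x' +i* y') (x +i* y); lra.
have mid : cabs ((x + h1) +i* y) < rho.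
  by apply: (inr _ _ _ _).1; [rewrite addrC addKr|rewrite subrr normr0].
have -> : F ((x +i* y : R[i]) + (h1 +i* h2)) - F (x +i* y) - f (x +i* y) * (h1 +i* h2) =
    (V (x + h1) (y + h2) - 'i * f (x +i* y) * (y + h2)%:C
      - (V (x + h1) y - 'i * f (x +i* y) * y%:C)) +
    (H y (x + h1) - f (x +i* y) * (x + h1)%:C - (H y x - f (x +i* y) * x%:C)).
  rewrite (F2 x y)//.
  rewrite (_ : (x +i* y : R[i]) + (h1 +i* h2) = (x + h1) +i* (y + h2))//.
  have -> : F ((x + h1) +i* (y + h2)) = F ((x + h1) +i* y) + (V (x + h1) (y + h2) - V (x + h1) y).
    by rewrite /F /=; ring.
  rewrite (F2 _ _ mid) (_ : h1 +i* h2 = h1%:C + 'i * h2%:C); last first.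
    by apply/eqP; rewrite eq_complex /=; apply/andP; split; apply/eqP; ring.
  rewrite !rmorphD; ring.
have lin (c : R[i]) t : rderive (fun s => c * s%:C) t c.
  have := rderive_affine 0 c t; rewrite /rderive => Ha e' /Ha[d' d'0 Hd'].
  by exists d' => // h /Hd'; rewrite !add0r.
rewrite (le_trans (cabsD _ _))// [in leRHS](splitr e) mulrDl lerD//.
  have B1 : cabs (V (x + h1) (y + h2) - 'i * f (x +i* y) * (y + h2)%:C
      - (V (x + h1) y - 'i * f (x +i* y) * y%:C)) <= e / 2 * `|y + h2 - y|.
    apply: (@mean_value_between R (fun s => V (x + h1) s - 'i * f (x +i* y) * s%:C)
      (fun s => 'i * f ((x + h1) +i* s) - 'i * f (x +i* y))) => t tb.
      apply: rderiveB; last exact: lin.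
      have [+ _] := inr (x + h1) t (ltac:(by rewrite addrC addKr))
        (le_trans (between_dist tb) (ltac:(by rewrite addrC addKr))).
      by move=> /normRI[? ?]; exact: HV.
    rewrite -mulrBr cabsM cabs_i mul1r ltW//.
    by apply: (inr _ _ _ _).2; [rewrite addrC addKr|rewrite (le_trans (between_dist tb))// addrC addKr].
  rewrite (le_trans B1)// ler_wpM2l ?(ltW e2)// addrC addKr.
  exact: (Im_le_cabs (h1 +i* h2)).
have B2 : cabs (H y (x + h1) - f (x +i* y) * (x + h1)%:C - (H y x - f (x +i* y) * x%:C))
    <= e / 2 * `|x + h1 - x|.
  apply: (@mean_value_between R (fun s => H y s - f (x +i* y) * s%:C)
    (fun s => f (s +i* y) - f (x +i* y))) => t tb.
    apply: rderiveB; last exact: lin.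
    have [+ _] := inr t y (le_trans (between_dist tb) (ltac:(by rewrite addrC addKr)))
       (ltac:(by rewrite subrr normr0)).
    by move=> /normRI[? ?]; exact: HH.
  rewrite ltW//.
  by apply: (inr _ _ _ _).2; [rewrite (le_trans (between_dist tb))// addrC addKr|rewrite subrr normr0].
rewrite (le_trans B2)// ler_wpM2l ?(ltW e2)// addrC addKr.
exact: (Re_le_cabs (h1 +i* h2)).
Qed.

Lemma cderive_local (f g : R[i]^o -> R[i]^o) (z a : R[i]^o) (d : R) : 0 < d ->
  (forall w, cabs (w - z) < d -> f w = g w) -> is_derive z 1 f a -> is_derive z 1 g a.
Proof.
move=> d0 fg /cderiveP H; apply/cderiveP => e /H[d' d'0 Hd'].
exists (Num.min d d'); first by rewrite lt_min d0.
move=> h; rewrite lt_min => /andP[h1 h2].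
rewrite -!fg; first exact: Hd'.
  by rewrite subrr cabs0.
by rewrite addrC addKr.
Qed.

Lemma ccontinuous_local (f g : R[i]^o -> R[i]^o) (z : R[i]^o) (d : R) : 0 < d ->
  (forall w, cabs (w - z) < d -> f w = g w) ->
  {for z, continuous f} -> {for z, continuous g}.
Proof.
move=> d0 fg /ccontinuousP H; apply/ccontinuousP => e /H[d' d'0 Hd'].
exists (Num.min d d'); first by rewrite lt_min d0.
move=> h; rewrite lt_min => /andP[h1 h2].
rewrite -!fg//; first exact: Hd'.
by rewrite subrr cabs0.
Qed.

Lemma primitive_on_disk (f : R[i]^o -> R[i]^o) (r rho : R) (E : seq R[i]) :
  0 < r -> r < rho -> (forall z, cabs z < rho -> {for z, continuous f}) ->
  (forall z, cabs z < rho -> z \notin E -> derivable f z 1) ->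
  exists F : R[i]^o -> R[i]^o,
    forall z, cabs z < r -> is_derive (z : R[i]^o) 1 F (f z).
Proof.
move=> r0 rrho fc df.
(* Composition with the radial retraction onto the disk of radius r makes f
   continuous everywhere. *)
pose p (z : R[i]^o) : R[i]^o := z * (r / Num.max r (cabs z))%:C.
have mx z : 0 < Num.max r (cabs z) by rewrite lt_max r0.
have pE z : cabs z <= r -> p z = z.
  by move=> zr; rewrite /p max_l// divff ?gt_eqF// mulr1.
have pr z : cabs (p z) <= r.
  rewrite /p cabsM cabsR ger0_norm ?divr_ge0 ?(ltW r0) ?(ltW (mx _))//.
  by rewrite mulrCA ler_piMr ?(ltW r0)// ler_pdivrMr// mul1r le_max lexx orbT.
have pc z : {for z, continuous p}.
  have [zr|rz] := ltP (cabs z) r.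
    apply: (@ccontinuous_local id p z (r - cabs z)); first by rewrite subr_gt0.
      move=> w wz; rewrite pE//.
      by have := cabs_le_sub w z; lra.
    exact: cvg_id.
  have zn0 : cabs z != 0 by rewrite gt_eqF// (lt_le_trans r0).
  apply/ccontinuousP => e e0; exists (e / 2); first by rewrite divr_gt0.
  move=> w wz.
  have mz : Num.max r (cabs z) = cabs z by rewrite max_r.
  rewrite /p mz.
  rewrite (_ : _ - _ = (w - z) * (r / Num.max r (cabs w))%:C +
     z * (r / Num.max r (cabs w) - r / cabs z)%:C); last first.
    by rewrite rmorphB; ring.
  rewrite (le_lt_trans (cabsD _ _))// (splitr e) ltr_leD//.
    rewrite cabsM cabsR ger0_norm ?divr_ge0 ?(ltW r0) ?(ltW (mx _))//.
    rewrite (le_lt_trans _ wz)// ler_piMr ?cabs_ge0//.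
    by rewrite ler_pdivrMr// mul1r le_max lexx.
  rewrite cabsM cabsR.
  have -> : r / Num.max r (cabs w) - r / cabs z =
      r / Num.max r (cabs w) * ((cabs z - Num.max r (cabs w)) / cabs z).
    by field; rewrite zn0 gt_eqF.
  have z0 : 0 < cabs z by rewrite cabs_gt0 -cabs_eq0.
  have -> (A D : R) : cabs z * `|A * (D / cabs z)| = `|A| * `|D|.
    by rewrite !normrM normfV (ger0_norm (cabs_ge0 z)); field.
  rewrite ger0_norm ?divr_ge0 ?(ltW r0) ?(ltW (mx _))//.
  rewrite (le_trans (ler_piMl _ _))// ?ler_pdivrMr// ?mul1r ?le_max ?lexx//.
  rewrite (le_trans _ (ltW wz))// -{1}mz.
  have h1 := cabs_sub_ge w z; have h2 := cabs_sub_ge z w; rewrite (cabsBC z) in h2.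
  by rewrite ler_norml; case: (leP r (cabs w)) => ?; rewrite mz; lra.
have [z||F HF] := @primitive_of_continuous (fun z => f (p z)) r E r0.
- apply: (@continuous_comp _ _ _ p f); first exact: pc.
  by apply: fc; rewrite (le_lt_trans (pr z)).
- move=> z zr zE.
  have [+ _] : is_derive (z : R[i]^o) 1 (fun z => f (p z)) ('D_1 f z).
    apply: (@cderive_local f _ _ _ (r - cabs z)); first by rewrite subr_gt0.
      move=> w wz; rewrite pE//.
      by have := cabs_le_sub w z; lra.
    by apply: derivableP; apply: df => //; exact: lt_trans rrho.
  exact.
exists F => z zr; have := HF z zr; rewrite pE//; exact: ltW.
Qed.

End PrimitiveOnDisk.

(** * Maximum principle and Cauchy estimates *)

Section ComplexCalculus.
Variable R : realType.
Implicit Types (f g : R[i]^o -> R[i]^o) (z : R[i]^o).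
Lemma ccontinuousB f g z : {for z, continuous f} -> {for z, continuous g} ->
  {for z, continuous (fun w => f w - g w : R[i]^o)}.
Proof. move=> cf cg. exact: (@continuousB _ _ _ f g z cf cg). Qed.
Lemma ccontinuousM f g z : {for z, continuous f} -> {for z, continuous g} ->
  {for z, continuous (fun w => f w * g w : R[i]^o)}.
Proof. move=> cf cg. exact: (@continuousM _ _ f g z cf cg). Qed.
Lemma ccontinuousV f z : {for z, continuous f} -> f z != 0 ->
  {for z, continuous (fun w => (f w)^-1 : R[i]^o)}.
Proof. move=> cf fz. exact: (@continuousV _ _ f z fz cf). Qed.
Lemma ccontinuous_cst (c : R[i]^o) z : {for z, continuous (fun=> c)}.
Proof. exact: cst_continuous. Qed.
Lemma ccontinuous_id z : {for z, continuous (fun w : R[i]^o => w)}.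
Proof. exact: cvg_id. Qed.

Lemma cderivableB f g z : derivable f z 1 -> derivable g z 1 ->
  derivable (fun w => f w - g w : R[i]^o) z 1.
Proof. by move=> df dg; exact: (@derivableB _ _ _ f g z 1 df dg). Qed.
Lemma cderivableM f g z : derivable f z 1 -> derivable g z 1 ->
  derivable (fun w => f w * g w : R[i]^o) z 1.
Proof. by move=> df dg; exact: (@derivableM _ _ f g z 1 df dg). Qed.
Lemma cderivableV f z : derivable f z 1 -> f z != 0 ->
  derivable (fun w => (f w)^-1 : R[i]^o) z 1.
Proof. by move=> df fz; exact: (@derivableV _ _ f z 1 fz df). Qed.
Lemma cderivable_cst (c : R[i]^o) z : derivable (fun=> c) z 1.
Proof. exact: derivable_cst. Qed.
Lemma cderivable_id z : derivable (fun w : R[i]^o => w) z 1.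
Proof. exact: derivable_id. Qed.
Lemma is_cderiveD f g z (a b : R[i]^o) : is_derive z 1 f a -> is_derive z 1 g b ->
  is_derive z 1 (fun w => f w + g w : R[i]^o) (a + b).
Proof. by move=> df dg; exact: (@is_deriveD _ _ _ f g z 1 a b df dg). Qed.
Lemma is_cderiveM f g z (a b : R[i]^o) : is_derive z 1 f a -> is_derive z 1 g b ->
  is_derive z 1 (fun w => f w * g w : R[i]^o) (f z * b + g z * a).
Proof. by move=> df dg; exact: (@is_deriveM _ _ f g z 1 a b df dg). Qed.
End ComplexCalculus.
Arguments ccontinuous_cst {R} c z [t] _.
Arguments ccontinuous_id {R} z [t] _.
Arguments cderivable_cst {R} c z [t] _.
Arguments cderivable_id {R} z [t] _.

Section MaximumPrinciple.
Variable R : realType.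
Implicit Types (z w : R[i]^o) (f g : R[i]^o -> R[i]^o).

Definition circ (r t : R) : R[i] := (r * cos t) +i* (r * sin t).

Lemma cabs_circ (r t : R) : 0 <= r -> cabs (circ r t) = r.
Proof.
move=> r0; apply/eqP; rewrite -(@eqrXn2 _ 2) ?cabs_ge0// cabs_sqr /= !exprMn -mulrDr.
by rewrite cos2Dsin2 mulr1.
Qed.

Lemma rderive_circ (r t : R) : rderive (circ r) t ('i * circ r t).
Proof.
have dc : is_derive t 1 (fun s : R => r * cos s : R) (r * - sin t).
  exact: is_deriveZ.
have ds : is_derive t 1 (fun s : R => r * sin s : R) (r * cos t).
  exact: is_deriveZ.
have := rderive_parts dc ds.
by rewrite (_ : 'i * circ r t = (r * - sin t) +i* (r * cos t))//; apply/eqP;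
  rewrite eq_complex /=; apply/andP; split; apply/eqP; ring.
Qed.

Lemma circle_param (r : R) z : 0 < r -> cabs z = r ->
  exists2 t : R, - pi <= t <= pi & z = circ r t.
Proof.
case: z => x y r0 zr.
have r2 : x ^+ 2 + y ^+ 2 = r ^+ 2 by rewrite -zr cabs_sqr.
have rn0 : r != 0 by rewrite gt_eqF.
have x1 : -1 <= x / r <= 1.
  rewrite ler_pdivlMr// ler_pdivrMr// mulN1r mul1r -ler_norml.
  by rewrite -zr; exact: (Re_le_cabs (x +i* y)).
have ysqrt : Num.sqrt (1 - (x / r) ^+ 2) = `|y| / r.
  rewrite (_ : 1 - _ = (y / r) ^+ 2); last first.
    by rewrite !expr_div_n (_ : y ^+ 2 = r ^+ 2 - x ^+ 2); [field|rewrite -r2; ring].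
  by rewrite sqrtr_sqr normrM normfV (ger0_norm (ltW r0)).
have := acos_ge0 x1; have := acos_lepi x1; have pi0 := pi_ge0 R => tpi t0.
have [y0|y0] := leP 0 y.
  exists (acos (x / r)); first by apply/andP; split; lra.
  rewrite /circ acosK ?in_itv// sin_acos// ysqrt ger0_norm//.
  by congr (_ +i* _); field.
exists (- acos (x / r)); first by apply/andP; split; lra.
rewrite /circ cosN sinN acosK ?in_itv// sin_acos// ysqrt ltr0_norm//.
by congr (_ +i* _); field.
Qed.

Lemma continuous_circ f (r : R) : 0 <= r ->
  (forall z, cabs z = r -> {for z, continuous f}) ->
  continuous (fun t : R => cabs (f (circ r t))).
Proof.
move=> r0 fc t; apply: continuous_epsP => e e0.
have [d d0 Hd] := (ccontinuousP _ _).1 (fc (circ r t) (cabs_circ t r0)) e e0.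
have [d' d'0 Hd'] := @rderive_circ r t 1 ltr01.
pose C := cabs ('i * circ r t) + 1.
have C0 : 0 < C by rewrite ltr_wpDl ?cabs_ge0.
exists (Num.min d' (d / C)); first by rewrite lt_min d'0 divr_gt0.
move=> s; rewrite lt_min => /andP[s1 s2].
have := Hd' _ s1; rewrite (_ : t + (s - t) = s) ?subrKC// mul1r => h1.
have : cabs (circ r s - circ r t) < d.
  move: s2; rewrite ltr_pdivlMr// => /(le_lt_trans _); apply.
  rewrite (le_trans (cabs_le_sub _ ('i * circ r t * (s - t)%:C)))//.
  rewrite [cabs (_ * _%:C)]cabsM cabsR /C mulrDr mulr1 addrC.
  by rewrite [X in X + _]mulrC lerD2l.
move=> /Hd; apply: le_lt_trans; rewrite ler_norml.
have := cabs_sub_ge (f (circ r s)) (f (circ r t)).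
have := cabs_sub_ge (f (circ r t)) (f (circ r s)).
rewrite (cabsBC (f (circ r t))); lra.
Qed.

(** Rolle's theorem for the closed curve t |-> Re (- i c Phi(r e^(it))), whose
   derivative is Re (c w phi(w)) at w = r e^(it).  This replaces integration along
   the circle. *)
Lemma circle_zero (r : R) (Phi phi : R[i]^o -> R[i]^o) (c : R[i]) : 0 < r ->
  (forall w, cabs w = r -> is_derive (w : R[i]^o) 1 Phi (phi w)) ->
  exists2 w, cabs w = r & complex.Re (c * (w * phi w)) = 0.
Proof.
move=> r0 H; pose gam := circ r.
have gamE t : cabs (gam t) = r by apply: cabs_circ; exact: ltW.
have gam' t : rderive gam t ('i * gam t) by exact: rderive_circ.
have pi2 : 0 < pi *+ 2 :> R by rewrite mulrn_wgt0// pi_gt0.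
have [t _] := rderive_MVT (c * - 'i) (ltW pi2)
  (fun t _ => rderive_comp (H (gam t) (gamE t)) (gam' t)).
have -> : gam (pi *+ 2) = gam 0.
  by rewrite /gam /circ cos2pi sin2pi cos0 sin0.
rewrite subrr mulr0 raddf0 subr0 => /esym/eqP.
rewrite mulf_eq0 [pi *+ 2 == 0]gt_eqF// orbF => /eqP E.
exists (gam t) => //; rewrite -[RHS]E; congr complex.Re.
rewrite (_ : c * - 'i * (phi (gam t) * ('i * gam t)) = - 'i ^+ 2 * (c * (gam t * phi (gam t)))); last by ring.
by rewrite sqr_i opprK mul1r.
Qed.

Definition dq (f : R[i]^o -> R[i]^o) (z : R[i]) : R[i]^o -> R[i]^o :=
  fun w => if w == z then 'D_1 f (z : R[i]^o) else (f w - f z) / (w - z).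

Lemma dqE f z w : f w = f z + (w - z) * dq f z w.
Proof.
rewrite /dq; have [->|wz] := eqVneq w z; first by rewrite subrr mul0r addr0.
by rewrite mulrC divfK ?subr_eq0// addrC subrK.
Qed.

Lemma dq_diag f z : dq f z z = 'D_1 f (z : R[i]^o).
Proof. by rewrite /dq eqxx. Qed.

Lemma dqC f z w : z != w -> dq f z w = dq f w z.
Proof.
move=> zw; rewrite /dq eq_sym (negbTE zw) -(opprB z w) -(opprB (f z)).
by rewrite invrN mulrNN.
Qed.

Lemma sub_neighborhood z w : w != z ->
  exists2 d : R, 0 < d & forall u, cabs (u - w) < d -> u != z.
Proof.
move=> wz; exists (cabs (w - z)); first by rewrite cabs_gt0 subr_eq0.
by move=> u h; apply: contraTneq h => ->; rewrite cabsBC ltxx.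
Qed.

Lemma dq_continuous f z w : {for w, continuous f} -> derivable f (z : R[i]^o) 1 ->
  {for w, continuous (dq f z)}.
Proof.
move=> fc fd; have [->|wz] := eqVneq w z.
  apply/ccontinuousP => e e0.
  have e2 : 0 < e / 2 by rewrite divr_gt0.
  have [d d0 Hd] := (cderiveP _ _ _).1 (derivableP fd) _ e2.
  exists d => // u ud; rewrite dq_diag /dq; have [_|uz] := eqVneq u z.
    by rewrite subrr cabs0.
  have := Hd _ ud; rewrite (_ : z + (u - z) = u) ?subrKC// => h.
  have uz0 : u - z != 0 by rewrite subr_eq0.
  rewrite -(ltr_pM2r (_ : 0 < cabs (u - z))) ?cabs_gt0// -cabsM mulrBl divfK//.
  rewrite (le_lt_trans h)// ltr_pM2r ?cabs_gt0//; lra.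
have [d d0 Hd] := sub_neighborhood wz.
have c1 := ccontinuousB fc (ccontinuous_cst (f z) w).
have c2 := ccontinuousB (ccontinuous_id w) (ccontinuous_cst z w).
refine (ccontinuous_local d0 _ (ccontinuousM c1 (ccontinuousV c2 _))).
  by move=> u /Hd uz; rewrite /dq (negbTE uz).
by rewrite subr_eq0.
Qed.

Lemma derivable_local f g (z : R[i]^o) (d : R) : 0 < d ->
  (forall w, cabs (w - z) < d -> f w = g w) -> derivable f z 1 -> derivable g z 1.
Proof.
move=> d0 fg /derivableP df.
by have [] := cderive_local d0 fg df.
Qed.

Lemma dq_derivable f z w : w != z -> derivable f (w : R[i]^o) 1 ->
  derivable (dq f z) (w : R[i]^o) 1.
Proof.
move=> wz fd; have [d d0 Hd] := sub_neighborhood wz.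
have c1 := cderivableB fd (cderivable_cst (f z) w).
have c2 := cderivableB (cderivable_id w) (cderivable_cst z w).
refine (derivable_local d0 _ (cderivableM c1 (cderivableV c2 _))).
  by move=> u /Hd uz; rewrite /dq (negbTE uz).
by rewrite subr_eq0.
Qed.

Lemma derivable_continuous f (z : R[i]^o) : derivable f z 1 -> {for z, continuous f}.
Proof. by move=> /derivable1_diffP /differentiable_continuous. Qed.

Let max_modulus_derivable f (r rho B : R) (E : seq R[i]) : 0 < r -> r < rho ->
  (forall z, cabs z < rho -> {for z, continuous f}) ->
  (forall z, cabs z < rho -> z \notin E -> derivable f z 1) ->
  (forall w, cabs w = r -> cabs (f w) <= B) ->
  forall z, cabs z < r -> derivable f z 1 -> cabs (f z) <= B.
Proof.
move=> r0 rrho fc fd fB z zr fz.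
have [->|fz0] := eqVneq (cabs (f z)) 0.
  rewrite (le_trans (cabs_ge0 _) (fB r%:C _))//.
  by rewrite cabsR ger0_norm// ltW.
(* The Poisson kernel of the circle is (r^2 - |z|^2) / |w - z|^2; the factor
   1 / ((w - z) (r^2 - conj z w)) times w is a positive real there. *)
pose k (w : R[i]^o) : R[i]^o := (r ^+ 2)%:C - z^* * w.
pose rho' := Num.min rho (r + (r - cabs z)).
have rr' : r < rho' by rewrite lt_min rrho; lra.
pose r' := (r + rho') / 2.
have [rr1 r1r'] : r < r' /\ r' < rho' by rewrite /r'; split; lra.
have kn0 w : cabs w < rho' -> k w != 0.
  rewrite lt_min => /andP[_ wr]; rewrite subr_eq0; apply/eqP => E0.
  have := congr1 (@cabs R) E0; rewrite cabsM cabs_conj cabsR ger0_norm ?sqr_ge0//.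
  have := cabs_ge0 w; have := cabs_ge0 z; nra.
have [w wrho'|w wrho' wE|F HF] := @primitive_on_disk R (fun w => dq f z w / k w) r' rho' (z :: E) (lt_trans r0 rr1) r1r'.
- have dc : {for w, continuous (dq f z)}.
    have wrho : cabs w < rho by move: wrho'; rewrite lt_min => /andP[].
    exact (dq_continuous (fc w wrho) fz).
  have c2 := ccontinuousB (ccontinuous_cst (r ^+ 2)%:C w)
      (ccontinuousM (ccontinuous_cst z^* w) (ccontinuous_id w)).
  refine (ccontinuous_local ltr01 _ (ccontinuousM dc (ccontinuousV c2 _))) => //.
  exact: kn0.
- move: wE; rewrite inE negb_or => /andP[wz wE].
  have dd : derivable (dq f z) (w : R[i]^o) 1.
    have wrho : cabs w < rho by move: wrho'; rewrite lt_min => /andP[].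
    exact (dq_derivable wz (fd w wrho wE)).
  have c2 := cderivableB (cderivable_cst (r ^+ 2)%:C w)
      (cderivableM (cderivable_cst z^* w) (cderivable_id w)).
  refine (derivable_local ltr01 _ (cderivableM dd (cderivableV c2 _))) => //.
  exact: kn0.
have [w wr /eqP] := circle_zero (f z)^* r0 (fun w wr => HF w (ltac:(by rewrite wr))).
have wz : w != z by apply: contraTneq zr => <-; rewrite wr ltxx.
have wz2 : 0 < cabs (w - z) ^+ 2 by rewrite exprn_gt0// cabs_gt0 subr_eq0.
have w0 : w != 0 by rewrite -cabs_eq0 wr gt_eqF.
have wz0 : w - z != 0 by rewrite subr_eq0.
have [u [un kE uE]] : exists u, [/\ u != 0, k w = w * u &
    (cabs (w - z) ^- 2)%:C = (w - z)^-1 * u^-1].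
  exists (w - z)^*; split; first by rewrite conjc_eq0.
    by rewrite /k rmorphB mulrBr [w * w^*]mulrC mul_conj_cabs wr [w * _]mulrC.
  by rewrite -invfM [_ * (w - z)^*]mulrC mul_conj_cabs fmorphV.
have -> : (f z)^* * (w * (dq f z w / k w)) = (f z)^* * (f w - f z) * (cabs (w - z) ^- 2)%:C.
  by rewrite kE uE /dq (negbTE wz); field; rewrite w0 un wz0.
rewrite Re_mulr_real mulf_eq0 invr_eq0 (gt_eqF wz2) orbF mulrBr mul_conj_cabs.
rewrite raddfB /= subr_eq0 => /eqP E0.
have fz1 : 0 < cabs (f z) by rewrite lt_def fz0 cabs_ge0.
rewrite -(ler_pM2l fz1) -expr2 -E0 (le_trans (ler_norm _))//.
rewrite (le_trans (Re_le_cabs _))// cabsM cabs_conj ler_pM2l//.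
exact: fB.
Qed.

Lemma isolated_seq (E : seq R[i]) z :
  exists2 d : R, 0 < d & forall w, 0 < cabs (w - z) < d -> w \notin E.
Proof.
elim: E => [|x E [d d0 Hd]]; first by exists 1.
have [->|xz] := eqVneq x z.
  exists d => // w /andP[w0 wd]; rewrite inE negb_or Hd ?w0// andbT.
  by rewrite -subr_eq0 -cabs_eq0 gt_eqF.
exists (Num.min d (cabs (x - z))); first by rewrite lt_min d0 cabs_gt0 subr_eq0.
move=> w; rewrite lt_min => /and3P[w0 wd wx]; rewrite inE negb_or Hd ?w0// andbT.
by apply: contraTneq wx => ->; rewrite ltxx.
Qed.

(** By continuity the bound passes from nearby points of differentiability to the
   points of E. *)
Lemma max_modulus f (r rho B : R) (E : seq R[i]) : 0 < r -> r < rho ->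
  (forall z, cabs z < rho -> {for z, continuous f}) ->
  (forall z, cabs z < rho -> z \notin E -> derivable f z 1) ->
  (forall w, cabs w = r -> cabs (f w) <= B) ->
  forall z, cabs z < r -> cabs (f z) <= B.
Proof.
move=> r0 rrho fc fd fB z zr; apply/ler_addgt0Pr => e e0.
have [d1 d10 Hd1] := isolated_seq E z.
have [d2 d20 Hd2] := (ccontinuousP f z).1 (fc z (lt_trans zr rrho)) e e0.
pose d := Num.min (r - cabs z) (Num.min d1 d2) / 2.
have m0 : 0 < Num.min (r - cabs z) (Num.min d1 d2) by rewrite !lt_min subr_gt0 zr d10.
have [dz dd1 dd2] : [/\ d < r - cabs z, d < d1 & d < d2].
  have dm : d < Num.min (r - cabs z) (Num.min d1 d2) by rewrite /d; lra.
  by move: dm; rewrite !lt_min => /and3P.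
have d0 : 0 < d by rewrite divr_gt0.
pose w := z + d%:C.
have wz : cabs (w - z) = d by rewrite /w addrC addKr cabsR ger0_norm// ltW.
have wr : cabs w < r by have := cabs_le_sub w z; lra.
have := max_modulus_derivable r0 rrho fc fd fB wr (fd _ _ _).
move=> /(_ (lt_trans wr rrho)); rewrite Hd1 ?wz ?d0// => /(_ isT).
have := Hd2 w; rewrite wz cabsBC => /(_ dd2).
have := cabs_le_sub (f z) (f w); lra.
Qed.

End MaximumPrinciple.

Section HolomorphicDerivative.
Variable R : realType.
Implicit Types (z w : R[i]^o) (f g : R[i]^o -> R[i]^o).

Lemma circle_bounded f (r : R) : 0 < r ->
  (forall z, cabs z = r -> {for z, continuous f}) ->
  exists2 B, 0 <= B & forall z, cabs z = r -> cabs (f z) <= B.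
Proof.
move=> r0 fc; have c := continuous_circ (ltW r0) fc.
have pi2 : - pi <= pi :> R by have := pi_ge0 R; lra.
have [t _ Ht] := EVT_max pi2 (continuous_subspaceT c).
exists (cabs (f (circ r t))); first exact: cabs_ge0.
move=> z /(circle_param r0)[s sI ->]; apply: Ht.
by rewrite in_itv.
Qed.

Section Lipschitz.
Variables (f : R[i]^o -> R[i]^o) (r rho r1 B : R) (E : seq R[i]).
Hypotheses (r0 : 0 < r) (rrho : r < rho) (r1r : r1 < r).
Hypothesis fc : forall z, cabs z < rho -> {for z, continuous f}.
Hypothesis fd : forall z, cabs z < rho -> z \notin E -> derivable f z 1.
Hypothesis fB : forall w, cabs w = r -> cabs (f w) <= B.

Let dqc z w : cabs w < rho -> derivable f z 1 -> {for w, continuous (dq f z)}.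
Proof. by move=> wr fz; exact: (dq_continuous (fc wr) fz). Qed.

Let dqd z w : cabs w < rho -> w \notin z :: E -> derivable (dq f z) w 1.
Proof.
rewrite inE negb_or => wr /andP[wz wE].
exact: (dq_derivable wz (fd wr wE)).
Qed.

Let circle_dist w z : cabs w = r -> cabs z <= r1 -> r - r1 <= cabs (w - z).
Proof. by move=> wr zr; have := cabs_sub_ge w z; lra. Qed.

Let circle_neq w z : cabs w = r -> cabs z <= r1 -> w - z != 0.
Proof.
by move=> wr zr; rewrite -cabs_gt0 (lt_le_trans _ (circle_dist wr zr))// subr_gt0 r1r.
Qed.

Let B0 : 0 <= B.
Proof.
rewrite (le_trans (cabs_ge0 _) (fB (w := r%:C) _))//.
by rewrite cabsR ger0_norm// ltW.
Qed.

Let dB z w : cabs z <= r1 -> cabs w = r -> cabs (f w - f z) <= 2 * B.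
Proof.
move=> zr wr; rewrite (le_trans (cabsB _ _))// mulr_natl mulr2n.
apply: lerD; first exact: fB.
by apply: (max_modulus r0 rrho (@fc) (@fd) (@fB)); exact: le_lt_trans r1r.
Qed.

Let dqB z w : cabs z <= r1 -> cabs w = r -> cabs (dq f z w) <= 2 * B / (r - r1).
Proof.
move=> zr wr; have wz := circle_neq wr zr.
rewrite /dq -subr_eq0 (negbTE wz) cabsM cabsV ler_pM ?cabs_ge0 ?invr_ge0 ?cabs_ge0 ?dB//.
by rewrite lef_pV2 ?posrE ?cabs_gt0 ?subr_gt0 ?circle_dist.
Qed.

Lemma dq_bounded z w : cabs z <= r1 -> derivable f z 1 -> cabs w < r ->
  cabs (dq f z w) <= 2 * B / (r - r1).
Proof.
move=> zr fz wr.
apply: (max_modulus r0 rrho (E := z :: E)) wr => [u ur|u ur uE|u ur].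
- exact: dqc.
- exact: dqd.
- exact: dqB.
Qed.

Lemma lipschitz_inside z w : cabs z <= r1 -> derivable f z 1 -> cabs w < r ->
  cabs (f w - f z) <= 2 * B / (r - r1) * cabs (w - z).
Proof.
move=> zr fz wr; rewrite (dqE f z w) addrC addKr cabsM mulrC.
by rewrite ler_wpM2r ?cabs_ge0// dq_bounded.
Qed.

(** For w on the circle the estimate is algebra, as w stays away from z and z'; it
   extends to the disk by the maximum principle. *)
Lemma dq_lipschitz z z' w : cabs z <= r1 -> cabs z' <= r1 -> cabs w < r ->
  derivable f z 1 -> derivable f z' 1 ->
  cabs (dq f z w - dq f z' w) <= 4 * B / (r - r1) ^+ 2 * cabs (z - z').
Proof.
move=> zr zr' wr fz fz'.
apply: (@max_modulus R (fun w => dq f z w - dq f z' w) r rho _ (z :: z' :: E) r0 rrho) wr => [u ur|u ur|u ur].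
- exact (ccontinuousB (dqc ur fz) (dqc ur fz')).
- rewrite !inE !negb_or => /and3P[uz uz' uE].
  exact (cderivableB (dq_derivable uz (fd ur uE)) (dq_derivable uz' (fd ur uE))).
have n1 := circle_neq ur zr; have n2 := circle_neq ur zr'.
have -> : dq f z u - dq f z' u =
    (f u - f z) / (u - z) * (z - z') / (u - z') + (f z' - f z) / (u - z').
  rewrite /dq -!(subr_eq0 u) (negbTE n1) (negbTE n2).
  by field; rewrite n1 n2.
have d0 : 0 < r - r1 by rewrite subr_gt0.
have inv u' : cabs u' <= r1 -> cabs (u - u')^-1 <= (r - r1)^-1.
  move=> hu; rewrite cabsV lef_pV2 ?posrE// ?(lt_le_trans d0 (circle_dist ur hu))//.
  exact: circle_dist.
rewrite (le_trans (cabsD _ _))//.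
have -> : 4 * B / (r - r1) ^+ 2 * cabs (z - z') =
   2 * B / (r - r1) * cabs (z - z') / (r - r1) + 2 * B / (r - r1) * cabs (z' - z) / (r - r1).
  by rewrite (cabsBC z'); field; rewrite gt_eqF.
apply: lerD; rewrite cabsM ler_pM ?cabs_ge0 ?inv//.
  rewrite cabsM ler_wpM2r ?cabs_ge0//.
  by rewrite cabsM ler_pM ?cabs_ge0 ?dB ?inv.
by apply: lipschitz_inside => //; exact: le_lt_trans r1r.
Qed.

End Lipschitz.

(** A function which is Lipschitz off a point has a limit there: the infimum of
   u h + C |h| is squeezed between the values. *)
Lemma lipschitz_limit (u : R[i] -> R) (C d : R) : 0 < d -> 0 <= C ->
  (forall h h', 0 < cabs h < d -> 0 < cabs h' < d -> `|u h - u h'| <= C * cabs (h - h')) ->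
  exists L, forall h, 0 < cabs h < d -> `|u h - L| <= C * cabs h.
Proof.
move=> d0 C0 H.
pose S := [set x | exists2 h, 0 < cabs h < d & x = u h + C * cabs h].
have le h h' : 0 < cabs h < d -> 0 < cabs h' < d -> u h' - C * cabs h' <= u h + C * cabs h.
  move=> hd hd'; have := H _ _ hd hd'; rewrite ler_norml => /andP[h1 h2].
  have := ler_wpM2l C0 (cabsB h h'); rewrite mulrDr; lra.
have S0 : S !=set0.
  exists (u (d / 2)%:C + C * cabs (d / 2)%:C); exists (d / 2)%:C => //.
  by rewrite cabsR ger0_norm ?divr_ge0 ?ltW//; apply/andP; split; lra.
exists (inf S) => h hd; rewrite ler_norml; apply/andP; split.
  have : inf S <= u h + C * cabs h.
    apply: ge_inf; last by exists h.
    by exists (u h - C * cabs h) => _ [h' hd' ->]; exact: le.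
  lra.
have : u h - C * cabs h <= inf S.
  by apply: lb_le_inf => // _ [h' hd' ->]; exact: le.
lra.
Qed.

(** Difference quotients of dq f z satisfy a Lipschitz bound in the base point, and
   therefore converge when the base point tends to z. *)
Lemma dq_derivable_diag f (rho : R) z :
  (forall z, cabs z < rho -> derivable f z 1) -> cabs z < rho ->
  derivable (dq f z) z 1.
Proof.
move=> fd zr.
have fc w : cabs w < rho -> {for w, continuous f}.
  by move=> /fd; exact: derivable_continuous.
pose r1 := (cabs z + rho) / 2; pose r := (r1 + rho) / 2.
have z0 := cabs_ge0 z.
have [zr1 r1r rrho r0] : [/\ cabs z < r1, r1 < r, r < rho & 0 < r].
  by rewrite /r /r1; split; lra.
pose q := dq f z.
have fz := fd z zr.
have qc w : cabs w < rho -> {for w, continuous q}.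
  by move=> wr; exact: (dq_continuous (fc w wr) fz).
have qd w : cabs w < rho -> w \notin [:: z] -> derivable q w 1.
  by rewrite inE => wr wz; exact: (dq_derivable wz (fd w wr)).
have [B B0 qB] := @circle_bounded q r r0 (fun w wr => qc w (ltac:(by rewrite wr))).
pose C := 4 * B / (r - r1) ^+ 2.
have C0 : 0 <= C by rewrite /C divr_ge0 ?sqr_ge0// mulr_ge0.
pose u (h : R[i]) := (q (z + h) - q z) / h.
have uE h : h != 0 -> u h = dq q (z + h) z.
  move=> h0; rewrite -dqC; first by rewrite /dq -subr_eq0 addrC addKr (negbTE h0).
  by rewrite -subr_eq0 opprD addrA subrr sub0r oppr_eq0.
pose d := r1 - cabs z.
have d0 : 0 < d by rewrite subr_gt0.
have uL h h' : 0 < cabs h < d -> 0 < cabs h' < d -> cabs (u h - u h') <= C * cabs (h - h').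
  move=> /andP[h0 hd] /andP[h0' hd']; rewrite !cabs_gt0 in h0 h0'.
  have in1 k : cabs k < d -> cabs (z + k) <= r1.
    by move=> kd; rewrite (le_trans (cabsD _ _))//; move: kd; rewrite /d; lra.
  have der k : k != 0 -> cabs k < d -> derivable q (z + k) 1.
    move=> k0 kd; apply: qd; first by rewrite (le_lt_trans (in1 k kd))//; lra.
    by rewrite inE -subr_eq0 addrC addKr.
  rewrite !uE//.
  have := @dq_lipschitz q r rho r1 B [:: z] r0 rrho r1r qc qd qB (z + h) (z + h') z
     (in1 h hd) (in1 h' hd') (lt_trans zr1 r1r) (der h h0 hd) (der h' h0' hd').
  by rewrite opprD addrACA subrr add0r.
have [|L1 H1] := @lipschitz_limit (fun h => complex.Re (u h)) C d d0 C0.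
  by move=> h h' hd hd'; rewrite -raddfB (le_trans (Re_le_cabs _))// uL.
have [|L2 H2] := @lipschitz_limit (fun h => complex.Im (u h)) C d d0 C0.
  by move=> h h' hd hd'; rewrite -raddfB (le_trans (Im_le_cabs _))// uL.
have [+ _] : is_derive z 1 q (L1 +i* L2); last by [].
apply/cderiveP => e e0; have C1 : 0 < 2 * C + 1 by lra.
exists (Num.min d (e / (2 * C + 1))); first by rewrite lt_min d0 divr_gt0.
move=> h; rewrite lt_min => /andP[hd he].
have [->|h0] := eqVneq h 0.
  by rewrite addr0 subrr mulr0 subr0 cabs0 mulr0.
have hd' : 0 < cabs h < d by rewrite cabs_gt0 h0.
rewrite (_ : _ - _ - _ = (u h - (L1 +i* L2)) * h); last first.
  by rewrite mulrBl divfK.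
rewrite cabsM ler_wpM2r ?cabs_ge0// (le_trans (cabs_le_ReIm _))//.
rewrite !raddfB /=.
have := H1 h hd'; have := H2 h hd'; move: he; rewrite ltr_pdivlMr//.
have := cabs_ge0 h; lra.
Qed.

Lemma dq_holomorphic f (rho : R) z :
  holomorphic_on_disk rho f -> disk rho z -> holomorphic_on_disk rho (dq f z).
Proof.
move=> fd /diskE zr w wr; have [->|wz] := eqVneq w z.
  by apply: (dq_derivable_diag (rho := rho)) => // u /diskE; exact: fd.
by apply: (dq_derivable wz); exact: fd.
Qed.

Lemma derive_dq f z w : derivable (dq f z) w 1 ->
  'D_1 f w = dq f z w + (w - z) * 'D_1 (dq f z) w.
Proof.
move=> dd.
have d1 : is_derive w 1 (fun u : R[i]^o => u - z : R[i]^o) 1.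
  by apply/cderiveP => e e0; exists 1 => // h _;
    rewrite (_ : _ - _ - _ = 0) ?cabs0 ?mulr_ge0 ?cabs_ge0 ?ltW//; ring.
have d2 := is_cderiveM d1 (derivableP dd).
have d3 : is_derive w 1 f ((w - z) * 'D_1 (dq f z) w + dq f z w * 1).
  have d4 : is_derive w 1 (fun=> f z) (0 : R[i]^o) by exact: is_derive_cst.
  have d5 := is_cderiveD d4 d2; rewrite add0r in d5.
  by apply: (cderive_local ltr01 _ d5) => u _; rewrite -dqE.
by case: d3 => _ ->; rewrite mulr1 addrC.
Qed.

(** With p = dq f z one has f'(w) = p(w) + (w - z) p'(w), and p' is Lipschitz near z;
   hence f' has derivative 2 p'(z) at z. *)
Lemma holomorphic_derive f (rho : R) :
  holomorphic_on_disk rho f -> holomorphic_on_disk rho (derive1 f).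
Proof.
move=> fh z zr; pose p := dq f z.
have ph : holomorphic_on_disk rho p := dq_holomorphic fh zr.
have zr' : cabs z < rho := (diskE rho z).1 zr.
pose r1 := (cabs z + rho) / 2; pose r := (r1 + rho) / 2.
have z0 := cabs_ge0 z.
have [zr1 r1r rrho r0] : [/\ cabs z < r1, r1 < r, r < rho & 0 < r].
  by rewrite /r /r1; split; lra.
have pd w : cabs w < rho -> derivable p w 1 by move=> /diskE; exact: ph.
have dE w : cabs w < rho -> 'D_1 f w = p w + (w - z) * 'D_1 p w.
  by move=> wr; exact: (derive_dq (pd w wr)).
clearbody p.
have pc w : cabs w < rho -> {for w, continuous p}.
  by move=> /pd; exact: derivable_continuous.
have [B B0 pB] := @circle_bounded p r r0 (fun w wr => pc w (ltac:(by rewrite wr))).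
pose C := 4 * B / (r - r1) ^+ 2.
have C0 : 0 <= C by rewrite /C divr_ge0 ?sqr_ge0// mulr_ge0.
have lip w : cabs w <= r1 -> cabs ('D_1 p w - 'D_1 p z) <= 2 * C * cabs (w - z).
  move=> wr; have [->|wz] := eqVneq w z; first by rewrite !subrr cabs0 mulr0.
  have dw := pd w (le_lt_trans wr (lt_trans r1r rrho)).
  have L u : cabs u < r -> cabs (dq p w u - dq p z u) <= C * cabs (w - z).
    move=> ur; exact (@dq_lipschitz p r rho r1 B [::] r0 rrho r1r pc (fun u ur _ => pd u ur) pB
      w z u wr (ltW zr1) ur dw (pd z zr')).
  rewrite -!dq_diag (_ : _ - _ = (dq p w w - dq p z w) + (dq p w z - dq p z z)); last first.
    by rewrite (_ : dq p w z = dq p z w); [ring|exact: dqC].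
  rewrite (le_trans (cabsD _ _))//.
  rewrite (_ : 2 * C * _ = C * cabs (w - z) + C * cabs (w - z)); last by ring.
  by apply: lerD; apply: L; lra.
have [+ _] : is_derive z 1 (derive1 f) ('D_1 p z * 2); last by [].
apply/cderiveP => e e0.
have e2 : 0 < e / 2 by rewrite divr_gt0.
have [d d0 Hd] := (cderiveP _ _ _).1 (derivableP (pd z zr')) _ e2.
have C1 : 0 < 2 * C + 1 by lra.
exists (Num.min d (Num.min (r1 - cabs z) (e / 2 / (2 * C + 1)))).
  by rewrite !lt_min d0 subr_gt0 zr1 divr_gt0.
move=> h; rewrite !lt_min => /and3P[hd hr he].
have hr1 : cabs (z + h) <= r1 by have := cabsD z h; lra.
have zhr : cabs (z + h) < rho by rewrite (le_lt_trans hr1)// (lt_trans r1r).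
have alg (a b x y t k : R[i]) : x + (t + k - t) * a - (y + (t - t) * b) - b * 2 * k =
    (x - y - b * k) + k * (a - b) by ring.
rewrite !derive1E (dE _ zhr) (dE _ zr') alg.
rewrite (le_trans (cabsD _ _))// [in leRHS](splitr e) mulrDl lerD ?Hd//.
rewrite cabsM mulrC ler_wpM2r ?cabs_ge0// (le_trans (lip _ hr1))//.
rewrite addrC addKr; move: he; rewrite ltr_pdivlMr//.
have := cabs_ge0 h; lra.
Qed.


Lemma holomorphic_derive1n f (rho : R) n :
  holomorphic_on_disk rho f -> holomorphic_on_disk rho (derive1n n f).
Proof.
move=> fh; elim: n => [//|n IH]; rewrite derive1nS; exact: holomorphic_derive.
Qed.

Lemma is_derive_derive1 f z : derivable f z 1 -> is_derive z 1 f (derive1 f z).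
Proof. by move=> fd; rewrite derive1E; exact: derivableP. Qed.

Lemma derive1n_mul_id p (rho : R) n z : holomorphic_on_disk rho p -> disk rho z ->
  derive1n n.+1 (fun w => w * p w : R[i]^o) z =
  z * derive1n n.+1 p z + n.+1%:R * derive1n n p z.
Proof.
move=> ph; elim: n z => [|n IH] z zr.
  have d1 := is_cderiveM (is_derive_id z 1) (is_derive_derive1 (ph z zr)).
  rewrite !derive1n1 derive1E; case: d1 => _ ->.
  by rewrite mulr1 mul1r.
have dn m : is_derive z 1 (derive1n m p) (derive1n m.+1 p z).
  by rewrite derive1nS; exact: is_derive_derive1 (holomorphic_derive1n (n := m) ph zr).
have d1 := is_cderiveM (is_derive_id z 1) (dn n.+1).
have d2 := is_cderiveM (is_derive_cst (n.+1%:R : R[i]^o) z 1) (dn n).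
have d3 := is_cderiveD d1 d2.
have zr' : 0 < rho - cabs z by rewrite subr_gt0; exact/diskE.
have alg (x a b c k : R[i]) : x * a + b * 1 + (k * b + c * 0) = x * a + (k + 1) * b by ring.
rewrite alg natr1 in d3.
have d4 : is_derive z 1 (derive1n n.+1 (fun w => w * p w : R[i]^o))
   (z * derive1n n.+2 p z + n.+2%:R * derive1n n.+1 p z).
  refine (cderive_local zr' _ d3) => w wz; rewrite IH//.
  by apply/diskE; have := cabs_le_sub w z; lra.
by rewrite derive1nS derive1E; case: d4.
Qed.

Lemma derive1n_addc (c : R[i]^o) f n :
  derive1n n.+1 (fun w => c + f w : R[i]^o) = derive1n n.+1 f.
Proof.
have E : derive1 (fun w => c + f w : R[i]^o) = derive1 f.
  apply/funext => z; rewrite /derive1.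
  have E' : (fun h => h^-1 *: ((c + f (h + z)) - (c + f z) : R[i]^o)) =
    (fun h => h^-1 *: (f (h + z) - f z)).
    by apply/funext => h; congr (_ *: _); rewrite opprD addrACA subrr add0r.
  by rewrite E'.
by rewrite /derive1n !iterSr E.
Qed.

Lemma taylor_coef0 f : taylor_coef f 0 = f 0.
Proof. by rewrite /taylor_coef /= divr1. Qed.

Lemma taylor_coef_dq f (rho : R) n : 0 < rho -> holomorphic_on_disk rho f ->
  taylor_coef f n.+1 = taylor_coef (dq f 0) n.
Proof.
move=> rho0 fh; have d0 : disk rho 0 by apply/diskE; rewrite cabs0.
have ph := dq_holomorphic fh d0.
have fE : f = (fun w => f 0 + w * dq f 0 w : R[i]^o).
  by apply/funext => w; have := dqE f 0 w; rewrite subr0.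
rewrite /taylor_coef [in LHS]fE derive1n_addc (derive1n_mul_id n ph d0).
move: (derive1n n.+1 _ 0) (derive1n n _ 0) => a b; rewrite mul0r add0r.
rewrite factS natrM invfM mulrA [_ * _ / n.+1%:R]mulrAC divff ?pnatr_eq0//.
by rewrite mul1r.
Qed.

Lemma is_cderive_inv_exp (n : nat) z : z != 0 ->
  is_derive z 1 (fun w : R[i]^o => (w ^+ n)^-1 : R[i]^o) (- n%:R * (z ^+ n.+1)^-1).
Proof.
move=> z0; have zn : z ^+ n != 0 by rewrite expf_neq0.
have dX := @exprn_derivable R[i] n z 1.
split; first exact: (@derivableV R[i] R[i]^o (fun w => w ^+ n) z 1 zn dX).
rewrite (@deriveV R[i] R[i]^o (fun w => w ^+ n) z 1 zn dX) exp_derive.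
rewrite -![_ *: _]/(_ * _); case: n {dX} zn => [|n] zn.
  by rewrite mulr0n !(mul0r, mulr0, oppr0).
rewrite /= !exprS; field.
by rewrite z0 expf_neq0.
Qed.

(** Induction on n by f(w) = f(0) + w p(w) with p = dq f 0, whose Taylor coefficients
   are those of f shifted by one. *)
Lemma taylor_remainder_primitive f (r rho : R) n : 0 < r -> r < rho ->
  holomorphic_on_disk rho f ->
  exists Phi : R[i]^o -> R[i]^o, forall w, cabs w = r ->
    is_derive w 1 Phi ((f w / w ^+ n - taylor_coef f n) / w).
Proof.
move=> r0 rrho; have rho0 := lt_trans r0 rrho.
have d0 : disk rho 0 by apply/diskE; rewrite cabs0.
elim: n f => [|n IH] f fh; have ph := dq_holomorphic fh d0.
  have pd w : cabs w < rho -> derivable (dq f 0) w 1 by move=> /diskE; exact: ph.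
  pose r' := (r + rho) / 2.
  have [rr' r'rho] : r < r' /\ r' < rho by rewrite /r'; split; lra.
  have [|w wr _|F HF] := @primitive_on_disk R (dq f 0) r' rho [::] (lt_trans r0 rr') r'rho.
  - by move=> w /pd; exact: derivable_continuous.
  - exact: pd.
  exists F => w wr; have := HF w (ltac:(by rewrite wr)).
  rewrite taylor_coef0 expr0 divr1 /dq subr0.
  by rewrite -cabs_eq0 wr gt_eqF.
have [Phi HPhi] := IH _ ph.
exists (fun w => (- f 0 / n.+1%:R) * (w ^+ n.+1)^-1 + Phi w) => w wr.
have w0 : w != 0 by rewrite -cabs_eq0 wr gt_eqF.
have d1 := is_cderiveM (is_derive_cst (- f 0 / n.+1%:R : R[i]^o) w 1) (is_cderive_inv_exp n.+1 w0).
have d2 := is_cderiveD d1 (HPhi w wr).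
have alg (x y a k : R[i]) : k != 0 -> - x / k * (- k * (w ^+ n.+2)^-1) + (w ^+ n.+1)^-1 * 0 +
   (y / w ^+ n - a) / w = ((x + (w - 0) * y) / w ^+ n.+1 - a) / w.
  by move=> k0; rewrite !exprS; field; rewrite w0 k0 expf_neq0.
rewrite (taylor_coef_dq n rho0 fh) (dqE f 0 w) -(alg _ _ _ n.+1%:R) ?pnatr_eq0//.
Qed.

(** If the coefficient a_n were too large, f(w) / w^n - a_n would stay in an open
   half plane with 0 on its boundary, against [circle_zero]. *)
Lemma cauchy_estimate f (r rho B : R) n : 0 < r -> r < rho ->
  holomorphic_on_disk rho f -> (forall w, cabs w = r -> cabs (f w) <= B) ->
  cabs (taylor_coef f n) <= B / r ^+ n.
Proof.
move=> r0 rrho fh fB; set a := taylor_coef f n.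
have rn0 : 0 < r ^+ n by rewrite exprn_gt0.
have B0 : 0 <= B.
  by rewrite (le_trans (cabs_ge0 _) (fB r%:C _))// cabsR ger0_norm// ltW.
have [->|a0] := eqVneq a 0; first by rewrite cabs0 divr_ge0// ltW.
have [Phi HPhi] := taylor_remainder_primitive n r0 rrho fh.
have [w wr /eqP] := circle_zero a^* r0 HPhi.
have w0 : w != 0 by rewrite -cabs_eq0 wr gt_eqF.
rewrite -/a [w * _]mulrC divfK// mulrBr mul_conj_cabs raddfB /= subr_eq0 => /eqP E.
have a1 : 0 < cabs a by rewrite cabs_gt0.
rewrite -(ler_pM2l a1) -expr2 -E (le_trans (ler_norm _))//.
rewrite (le_trans (Re_le_cabs _))// cabsM cabs_conj ler_pM2l// cabsM cabsV cabsX wr.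
by rewrite ler_wpM2r ?fB// invr_ge0 ltW.
Qed.

End HolomorphicDerivative.

(** * Polynomials *)

Section Polynomials.
Variable R : realType.
Implicit Types (p q s : {poly R[i]}) (z w c : R[i]) (t : R).

Definition wnorm t p : R := \sum_(i < size p) cabs p`_i * t ^+ i.

Lemma wnormE t p n : (size p <= n)%N -> wnorm t p = \sum_(i < n) cabs p`_i * t ^+ i.
Proof.
move=> pn; rewrite /wnorm (big_ord_widen n (fun i => cabs p`_i * t ^+ i))// big_mkcond.
apply: eq_bigr => i _; case: ltnP => // h.
by rewrite nth_default// cabs0 mul0r.
Qed.

Lemma wnorm_ge0 t p : 0 <= t -> 0 <= wnorm t p.
Proof. by move=> t0; apply: sumr_ge0 => i _; rewrite mulr_ge0 ?cabs_ge0 ?exprn_ge0. Qed.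

Lemma coef_le_wnorm t p i : 0 <= t -> cabs p`_i * t ^+ i <= wnorm t p.
Proof.
move=> t0; have [ip|pi] := ltnP i (size p); last first.
  by rewrite nth_default// cabs0 mul0r wnorm_ge0.
rewrite /wnorm (bigD1 (Ordinal ip))//= lerDl sumr_ge0// => j _.
by rewrite mulr_ge0 ?cabs_ge0 ?exprn_ge0.
Qed.

Lemma wnorm_eq0 p : (wnorm 1 p == 0) = (p == 0).
Proof.
apply/eqP/eqP => [p0|->]; last by rewrite /wnorm size_poly0 big_ord0.
apply/polyP => i; rewrite coef0; apply/eqP; rewrite -cabs_eq0 eq_le cabs_ge0 andbT.
by have := coef_le_wnorm p i (@ler01 R); rewrite p0 expr1n mulr1.
Qed.

Lemma horner_le_wnorm p z : cabs p.[z] <= wnorm (cabs z) p.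
Proof.
rewrite horner_coef (le_trans (cabs_sum _ _ _))// ler_sum// => i _.
by rewrite cabsM cabsX.
Qed.

Lemma horner_le_pow p z n (P : R) : (size p <= n.+1)%N -> cabs z <= P -> 1 <= P ->
  cabs p.[z] <= P ^+ n * wnorm 1 p.
Proof.
move=> pn zP P1; rewrite (le_trans (horner_le_wnorm p z))//.
rewrite !(wnormE _ pn) mulr_sumr ler_sum// => i _; rewrite expr1n mulr1 mulrC.
rewrite ler_wpM2r ?cabs_ge0// (le_trans (_ : _ <= P ^+ i))//.
  by rewrite lerXn2r ?nnegrE ?cabs_ge0// (le_trans ler01).
by rewrite ler_weXn2l// -ltnS.
Qed.

Lemma wnorm_mulXsubC t p c : 0 <= t ->
  wnorm t (p * ('X - c%:P)) <= (t + cabs c) * wnorm t p.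
Proof.
move=> t0; have sz : (size (p * ('X - c%:P))%R <= (size p).+1)%N.
  by rewrite (leq_trans (size_polyMleq _ _))// size_XsubC addn2.
rewrite (wnormE _ sz) mulrDl.
have -> : t * wnorm t p = \sum_(i < (size p).+1) cabs (p * 'X)`_i * t ^+ i.
  rewrite big_ord_recl coefMX eqxx cabs0 mul0r add0r /wnorm mulr_sumr.
  by apply: eq_bigr => i _; rewrite coefMX /= exprS mulrCA.
rewrite (wnormE t (leqnSn (size p))) mulr_sumr -big_split ler_sum// => i _.
rewrite /= mulrBr coefB coefMC [cabs c * _]mulrA -mulrDl ler_wpM2r ?exprn_ge0//.
by rewrite (le_trans (cabsB _ _))// cabsM [cabs c * _]mulrC.
Qed.

Lemma wnorm_prod t a (rs : seq R[i]) : 0 <= t ->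
  wnorm t (a *: \prod_(c <- rs) ('X - c%:P)) <= cabs a * \prod_(c <- rs) (t + cabs c).
Proof.
move=> t0; elim: rs => [|c rs IH].
  rewrite !big_nil alg_polyC (wnormE t (size_polyC_leq1 a)).
  by rewrite big_ord1 coefC eqxx expr0 mulr1.
rewrite !big_cons [('X - c%:P) * _]mulrC scalerAl.
rewrite (le_trans (wnorm_mulXsubC _ _ t0))// mulrCA.
by rewrite ler_wpM2l// addr_ge0 ?cabs_ge0.
Qed.

Lemma cabs_horner_prod a (rs : seq R[i]) z :
  cabs (a *: \prod_(c <- rs) ('X - c%:P)).[z] = cabs a * \prod_(c <- rs) cabs (z - c).
Proof.
rewrite hornerZ cabsM; congr (_ * _).
elim: rs => [|c rs IH]; first by rewrite !big_nil hornerC cabs1.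
by rewrite !big_cons hornerM cabsM IH !hornerE.
Qed.

Lemma ler_prod_seq (rs : seq R[i]) (F G : R[i] -> R) :
  (forall c, c \in rs -> 0 <= F c <= G c) ->
  \prod_(c <- rs) F c <= \prod_(c <- rs) G c.
Proof.
move=> H; rewrite big_seq [leRHS]big_seq.
by apply: ler_prod => c; exact: H.
Qed.

Lemma complex_poly_split p :
  exists rs : seq R[i], p = lead_coef p *: \prod_(c <- rs) ('X - c%:P).
Proof. by have [rs E] := closed_field_poly_normal p; exists rs; exact: E. Qed.

Lemma poly_split_size p (rs : seq R[i]) : p != 0 ->
  p = lead_coef p *: \prod_(c <- rs) ('X - c%:P) -> size p = (size rs).+1.
Proof.
move=> p0 E; have l0 : lead_coef p != 0 by rewrite lead_coef_eq0.
rewrite E -(size_prod_XsubC rs id); exact: (size_scale _ l0).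
Qed.

(** If no root is smaller than t, the coefficients are controlled by the constant
   one. *)
Lemma small_root p t n j : (size p <= n.+1)%N -> 0 < t ->
  2 ^+ n * cabs p`_0 < cabs p`_j * t ^+ j -> exists2 w, cabs w < t & root p w.
Proof.
move=> pn t0 H; have p0 : p != 0.
  by apply: contraTneq H => ->; rewrite !coef0 cabs0 mul0r mulr0 ltxx.
have [rs E] := complex_poly_split p.
have [//|nr] := pselect (exists2 w, cabs w < t & root p w); exfalso.
have rst c : c \in rs -> t <= cabs c.
  move=> crs; case: (leP t (cabs c)) => // ct; case: nr; exists c => //.
  by rewrite rootE -cabs_eq0 E cabs_horner_prod (big_rem c crs) /= subrr cabs0 mul0r mulr0.
have szrs : (size rs <= n)%N.
  move: pn; rewrite (poly_split_size p0 E) ltnS; exact.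
move: H; apply/negP; rewrite -leNgt.
rewrite (le_trans (coef_le_wnorm p j (ltW t0)))// {1}E.
rewrite (le_trans (wnorm_prod _ _ (ltW t0)))//.
have -> : cabs p`_0 = cabs (lead_coef p) * \prod_(c <- rs) cabs c.
  rewrite -horner_coef0 {1}E cabs_horner_prod; congr (_ * _).
  by apply: eq_bigr => c _; rewrite sub0r cabsN.
rewrite mulrCA ler_wpM2l ?cabs_ge0//.
rewrite (le_trans (ler_prod_seq (G := fun c => 2 * cabs c) _))//.
  move=> c crs; rewrite addr_ge0 ?cabs_ge0 ?(ltW t0)//=.
  by have := rst c crs; lra.
rewrite big_split /= ler_wpM2r ?prodr_ge0// => [c _|]; first exact: cabs_ge0.
by rewrite big_const_seq count_predT iter_mulr_1 ler_weXn2l// ler1n.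
Qed.

(** When |w| grows from t to 3 t, the other monomials gain at most a factor 3^n on
   the one of degree j, which therefore still exceeds their sum. *)
Lemma no_root_annulus p (t e : R) n j w : (size p <= n.+1)%N -> 0 < t -> 0 <= e ->
  (j <= n)%N -> p`_j != 0 ->
  (forall i, (i <= n)%N -> i != j -> cabs p`_i * t ^+ i <= e * (cabs p`_j * t ^+ j)) ->
  n.+1%:R * 3 ^+ n * e < 1 -> t <= cabs w <= 3 * t -> p.[w] != 0.
Proof.
move=> pn t0 e0 jn pj H ne /andP[tw wt]; apply/negP => /eqP pw.
pose u := cabs w / t.
have wE : cabs w = u * t by rewrite /u divfK// gt_eqF.
have [u1 u3] : 1 <= u /\ u <= 3 by rewrite /u ler_pdivlMr// ler_pdivrMr// mul1r.
have u0 : 0 <= u by rewrite (le_trans ler01).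
pose M := cabs p`_j * t ^+ j * u ^+ j.
have M0 : 0 < M by rewrite /M !mulr_gt0 ?cabs_gt0// exprn_gt0// (lt_le_trans ltr01).
have term i : (i <= n)%N -> i != j -> cabs (p`_i * w ^+ i) <= 3 ^+ n * e * M.
  move=> iln ij; rewrite cabsM cabsX wE exprMn mulrCA mulrC.
  have -> : 3 ^+ n * e * M = (e * (cabs p`_j * t ^+ j)) * (3 ^+ n * u ^+ j).
    by rewrite /M; ring.
  have c0 := cabs_ge0 p`_i.
  apply: ler_pM; [by rewrite mulr_ge0// exprn_ge0// ltW|by rewrite exprn_ge0|exact: H|].
  rewrite (le_trans (_ : _ <= 3 ^+ n))//.
    rewrite (le_trans (_ : _ <= 3 ^+ i))//; first by rewrite lerXn2r ?nnegrE.
    by rewrite ler_weXn2l// ler1n.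
  by rewrite ler_peMr ?exprn_ge0// exprn_ege1.
have jn' : (j < n.+1)%N by rewrite ltnS.
have := pw; rewrite (horner_coef_wide _ pn) (bigD1 (Ordinal jn'))//= => /eqP.
rewrite addr_eq0 => /eqP /(congr1 (@cabs R)); rewrite cabsN cabsM cabsX wE exprMn.
rewrite [u ^+ j * _]mulrC mulrA -/M => ME.
suff : M <= n.+1%:R * (3 ^+ n * e * M).
  move=> le1; have : n.+1%:R * 3 ^+ n * e * M < M by rewrite gtr_pMl.
  by rewrite ltNge => /negP; apply; rewrite -!mulrA in le1 *.
rewrite {1}ME (le_trans (cabs_sum _ _ _))//.
rewrite (le_trans (ler_sum _ (G := fun=> 3 ^+ n * e * M) _))//.
  move=> i ij; apply: term; first by rewrite -ltnS.
  by apply: contraNneq ij => ij; apply/eqP/val_inj.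
rewrite sumr_const -[leLHS]mulr_natl ler_wpM2r ?ler_nat//.
  by rewrite mulr_ge0 ?(ltW M0)// mulr_ge0 ?exprn_ge0.
by rewrite (leq_trans (max_card _))// card_ord.
Qed.

(** One of the outer thirds of the interval stays away from the first point;
   continue inside it. *)
Lemma avoid_points (rs : seq R) (a b : R) : a < b ->
  exists2 r, a < r < b & forall x, x \in rs -> (b - a) / (4 * 3 ^+ size rs) <= `|r - x|.
Proof.
elim: rs a b => [|x rs IH] a b ab.
  by exists ((a + b) / 2) => //; apply/andP; split; lra.
have [p [q [pq ap qb L far]]] : exists p q : R, [/\ p < q, a <= p, q <= b, q - p = (b - a) / 3 &
    forall r, p < r < q -> (b - a) / 6 <= `|r - x|].
  have [xm|mx] := leP x ((a + b) / 2).
    exists (b - (b - a) / 3), b; split; try lra.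
    move=> r /andP[? ?]; rewrite (le_trans _ (ler_norm _))//; lra.
  exists a, (a + (b - a) / 3); split; try lra.
  move=> r /andP[? ?]; rewrite distrC (le_trans _ (ler_norm _))//; lra.
have [r /andP[pr rq] Hr] := IH p q pq.
exists r; first by apply/andP; split; lra.
have p3 : 1 <= 3 ^+ size rs :> R by rewrite exprn_ege1// ler1n.
move=> y; rewrite inE => /orP[/eqP ->|/Hr].
  rewrite (le_trans _ (far r _)) ?pr// ler_pM2l ?subr_gt0//.
  by rewrite lef_pV2 ?posrE ?mulr_gt0 ?exprn_gt0// /= exprS; lra.
apply: le_trans; rewrite L /= exprS le_eqVlt; apply/orP; left; apply/eqP; field.
by rewrite gt_eqF// exprn_gt0.
Qed.

(** The radius is chosen away from the moduli of the roots c.  On that circle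
   |z - c| is at least a constant times 1 + |c|, and the product of the latter
   bounds the coefficients. *)
Lemma good_circle n (del P : R) : 0 < del -> 1 <= P -> exists2 c, 0 < c &
  forall s (ra rb : R), (size s <= n.+1)%N -> 0 <= ra -> rb <= P -> del <= rb - ra ->
    exists2 r, ra < r < rb & forall z, cabs z = r -> c * wnorm 1 s <= cabs s.[z].
Proof.
move=> del0 P1; pose eta := del / (4 * 3 ^+ n); pose kap := eta / (1 + P + eta).
have eta0 : 0 < eta by rewrite divr_gt0// mulr_gt0// exprn_gt0.
have kap0 : 0 < kap by rewrite divr_gt0//; lra.
have kap1 : kap <= 1 by rewrite ler_pdivrMr; lra.
exists (kap ^+ n); first by rewrite exprn_gt0.
move=> s ra rb sn ra0 rbP drb.
have [->|s0] := eqVneq s 0.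
  have [] := @avoid_points [::] ra rb; first lra.
  move=> r rI _; exists r => // z _.
  by rewrite horner0 cabs0 /wnorm size_poly0 big_ord0 mulr0.
have [rs E] := complex_poly_split s.
have szrs : (size rs <= n)%N by move: sn; rewrite (poly_split_size s0 E) ltnS; exact.
have [] := @avoid_points (map (@cabs R) rs) ra rb; first lra.
move=> r rI Hr; exists r => // z zr.
have far c : c \in rs -> kap * (1 + cabs c) <= cabs (z - c).
  move=> crs; have : eta <= cabs (z - c).
    rewrite (le_trans (_ : _ <= `|r - cabs c|))//.
      apply: le_trans (Hr _ (map_f _ crs)); rewrite size_map.
      rewrite /eta; apply: ler_pM; rewrite ?invr_ge0 ?mulr_ge0 ?exprn_ge0 ?(ltW del0)//.
      rewrite lef_pV2 ?posrE ?mulr_gt0 ?exprn_gt0// ler_pM2l//.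
      by rewrite ler_weXn2l// ler1n.
    rewrite -zr ler_norml; have := cabs_sub_ge z c; have := cabs_sub_ge c z.
    by rewrite (cabsBC c); lra.
  move=> h; rewrite /kap mulrAC ler_pdivrMr; last lra.
  have := cabs_le_sub c z; rewrite (cabsBC c); move/andP: rI => [? ?] h2.
  have [zP c0] : cabs z <= P /\ 0 <= cabs (z - c) by split; [lra|exact: cabs_ge0].
  nra.
rewrite {2}E cabs_horner_prod.
rewrite (le_trans (_ : _ <= kap ^+ n * (cabs (lead_coef s) * \prod_(c <- rs) (1 + cabs c))))//.
  rewrite ler_wpM2l ?exprn_ge0 ?(ltW kap0)// {1}E.
  exact: wnorm_prod.
rewrite mulrCA ler_wpM2l ?cabs_ge0//.
rewrite (le_trans (_ : _ <= \prod_(c <- rs) (kap * (1 + cabs c))))//.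
  rewrite big_split /= big_const_seq count_predT iter_mulr_1 ler_wpM2r//.
    by rewrite prodr_ge0// => c _; rewrite addr_ge0 ?cabs_ge0.
  by rewrite ler_wiXn2l// ltW.
by apply: ler_prod_seq => c crs; rewrite far// mulr_ge0 ?addr_ge0 ?cabs_ge0// ltW.
Qed.

(** The coefficients are the image of the values by the inverse of a Vandermonde
   matrix. *)
Lemma interpolation_bound n (x : 'I_n.+1 -> R[i]) : injective x ->
  exists2 c, 0 <= c & forall s (B : R), (size s <= n.+1)%N ->
    (forall l, cabs s.[x l] <= B) -> wnorm 1 s <= c * B.
Proof.
move=> xinj; pose V := Vandermonde n.+1 (\row_l x l).
have Vu : V \in unitmx.
  rewrite unitmxE det_Vandermonde unitfE; apply/prodf_neq0 => i _.
  apply/prodf_neq0 => j ij; rewrite !mxE subr_eq0 (inj_eq xinj).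
  by apply: contraTneq ij => ->; rewrite ltnn.
exists (\sum_(i < n.+1) \sum_(l < n.+1) cabs (invmx V l i)).
  by apply: sumr_ge0 => i _; apply: sumr_ge0 => l _; exact: cabs_ge0.
move=> s B sn sB; rewrite (wnormE _ sn) mulr_suml ler_sum// => i _.
pose v := \row_(l < n.+1) s.[x l].
have vE : v = (\row_(i < n.+1) s`_i) *m V.
  apply/rowP => l; rewrite !mxE (horner_coef_wide _ sn).
  by apply: eq_bigr => j _; rewrite !mxE.
have -> : s`_i = (v *m invmx V) 0 i by rewrite vE mulmxK// mxE.
rewrite expr1n mulr1 mxE (le_trans (cabs_sum _ _ _))// mulr_suml ler_sum// => l _.
by rewrite cabsM mxE mulrC ler_wpM2l ?cabs_ge0.
Qed.

End Polynomials.

(** * A dominant monomial *)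

Section DominantScale.
Variable R : realType.

(** If the monomial of index p is the largest at t, then at t L it dominates those of
   smaller index; either it dominates all of them, or at t L^2 the largest monomial
   has an index greater than p. *)
Let dominant_scale_from (sg : nat -> R) (k : nat) (L : R) : (forall j, 0 <= sg j) -> 1 < L ->
  forall n p (t : R), (k - p <= n)%N -> (p <= k)%N -> 0 < sg p -> 0 < t ->
  (forall j, (j <= k)%N -> sg j * t ^+ j <= sg p * t ^+ p) ->
  exists (t' : R) (q : nat), [/\ t <= t' <= t * L ^+ (2 * n + 1), (q <= k)%N, 0 < sg q &
    forall j, (j <= k)%N -> j != q -> L * (sg j * t' ^+ j) <= sg q * t' ^+ q].
Proof.
move=> sg0 L1; have L0 : 0 < L by lra.
have LX m i : (m <= i)%N -> L ^+ m <= L ^+ i by move=> mi; rewrite ler_weXn2l// ltW.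
elim=> [|n IH] p t kp pk sgp t0 Hp.
  have pE : p = k by apply/eqP; rewrite eqn_leq pk -subn_eq0 -leqn0.
  subst p.
  exists (t * L), k; split => //.
    by rewrite muln0 add0n expr1 lexx andbT ler_pMr// ltW.
  move=> j jk jNk; have jlt : (j < k)%N by rewrite ltn_neqAle jNk.
  rewrite (_ : L * _ = sg j * t ^+ j * L ^+ j.+1); last by rewrite exprMn exprS; ring.
  rewrite exprMn (mulrA (sg k)).
  by apply: ler_pM; rewrite ?mulr_ge0 ?exprn_ge0 ?sg0 ?(ltW t0) ?(ltW L0) ?Hp ?LX.
pose t1 := t * L; pose t2 := t1 * L.
have t10 : 0 < t1 by rewrite mulr_gt0.
have t20 : 0 < t2 by rewrite mulr_gt0.
have [Hup|] := pselect (forall j, (p < j <= k)%N -> L * (sg j * t1 ^+ j) <= sg p * t1 ^+ p).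
  exists t1, p; split => //.
    apply/andP; split; first by rewrite /t1 ler_pMr// ltW.
    by rewrite /t1 ler_wpM2l ?(ltW t0)// -[leLHS]expr1 LX// addn1.
  move=> j jk jp; have [pj|jlt|jE] := ltngtP p j.
  - by apply: Hup; rewrite pj.
  - rewrite (_ : L * _ = sg j * t ^+ j * L ^+ j.+1); last by rewrite /t1 exprMn exprS; ring.
    rewrite /t1 exprMn (mulrA (sg p)).
    by apply: ler_pM; rewrite ?mulr_ge0 ?exprn_ge0 ?sg0 ?(ltW t0) ?(ltW L0) ?Hp ?LX.
  - by rewrite jE eqxx in jp.
move=> /existsNP[j /not_implyP[/andP[pj jk] /negP]]; rewrite -ltNge => Hj.
have jk' : (j < k.+1)%N by rewrite ltnS.
pose F (i : 'I_k.+1) := sg i * t2 ^+ i.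
case: (@arg_maxP _ _ _ (Ordinal jk') (fun i : 'I_k.+1 => (p < i)%N) F pj) => q pq Hq.
have step : sg p * t2 ^+ p <= sg j * t2 ^+ j.
  have L0' m : 0 <= L ^+ m by rewrite exprn_ge0// ltW.
  have t2E m : sg m * t2 ^+ m = sg m * t1 ^+ m * L ^+ m.
    by rewrite -mulrA -exprMn.
  rewrite !t2E (le_trans (ler_wpM2r (L0' p) (ltW Hj)))//.
  rewrite (_ : L * _ * _ = sg j * t1 ^+ j * L ^+ p.+1); last by rewrite exprS; ring.
  by rewrite ler_wpM2l ?LX// mulr_ge0// exprn_ge0// ltW.
have qk : (q <= k)%N by rewrite -ltnS.
have jq : sg j * t2 ^+ j <= sg q * t2 ^+ q := Hq (Ordinal jk') pj.
have sgq : 0 < sg q.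
  have : 0 < sg q * t2 ^+ q by rewrite (lt_le_trans _ jq)// (lt_le_trans _ step)// mulr_gt0 ?exprn_gt0.
  by rewrite pmulr_lgt0// exprn_gt0.
have [|i ik|t' [q' [/andP[tt' t't] q'k sgq' Hq']]] := IH q t2 _ qk sgq t20.
- by rewrite leq_subLR in kp; rewrite leq_subLR (leq_trans kp)// addnS -addSn leq_add2r.
- have [pi|ip] := ltnP p i.
    have ik' : (i < k.+1)%N by rewrite ltnS.
    exact: (Hq (Ordinal ik') pi).
  apply: le_trans jq; apply: le_trans step.
  have t2E m : sg m * t2 ^+ m = sg m * t ^+ m * L ^+ (2 * m).
    by rewrite exprM -mulrA -exprMn expr2 mulrA.
  rewrite !t2E.
  by apply: ler_pM; rewrite ?mulr_ge0 ?exprn_ge0 ?sg0 ?(ltW t0) ?(ltW L0) ?Hp ?LX// leq_mul2l.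
exists t', q'; split => //; apply/andP; split.
  rewrite (le_trans _ tt')// /t2 /t1 -mulrA ler_pMr//.
  by rewrite -expr2 exprn_ege1// ltW.
rewrite (le_trans t't)// /t2 /t1 -!mulrA ler_wpM2l ?(ltW t0)//.
by rewrite -!exprS LX// mulnS -addnA add2n.
Qed.

(** As t grows, the index of the largest monomial increases, at most k times;
   between two increases far enough from each other it dominates by a factor L. *)
Lemma dominant_scale (sg : nat -> R) (k : nat) (L t0 : R) : (forall j, 0 <= sg j) -> 1 < L ->
  0 < t0 -> (exists2 j, (j <= k)%N & 0 < sg j) ->
  exists (t : R) (q : nat), [/\ t0 <= t <= t0 * L ^+ (2 * k + 1), (q <= k)%N, 0 < sg q &
    forall j, (j <= k)%N -> j != q -> L * (sg j * t ^+ j) <= sg q * t ^+ q].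
Proof.
move=> sg0 L1 t00 [j jk sgj].
have jk' : (j < k.+1)%N by rewrite ltnS.
pose F (i : 'I_k.+1) := sg i * t0 ^+ i.
case: (@arg_maxP _ _ _ (Ordinal jk') xpredT F isT) => p _ Hp.
apply: (dominant_scale_from sg0 L1 (p := p)) => //.
- by rewrite leq_subLR leq_addl.
- by rewrite -ltnS.
- have : 0 < sg p * t0 ^+ p.
    by rewrite (lt_le_trans _ (Hp (Ordinal jk') isT))// mulr_gt0 ?exprn_gt0.
  by rewrite pmulr_lgt0// exprn_gt0.
- by move=> i ik; have ik' : (i < k.+1)%N by []; exact: (Hp (Ordinal ik') isT).
Qed.

End DominantScale.

(** * Disjoint graphs *)

Section Graphs.
Variable R : realType.
Implicit Types (z w : R[i]^o) (g h : R[i]^o -> R[i]^o).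

Lemma uniform_radius (T : Type) (F : set T) (k : nat) (Q : T -> R -> Prop) :
  F #<= `I_k -> (forall A d d', 0 < d' <= d -> Q A d -> Q A d') ->
  (forall A, F A -> exists2 d, 0 < d & Q A d) ->
  exists2 d, 0 < d & forall A, F A -> Q A d.
Proof.
move=> /pcard_leP/unsquash f mono H.
have fk A : F A -> (f A < k)%N by move=> FA; exact: (@funS _ _ F `I_k f A FA).
have finj : {in F &, injective f} by exact: inj.
suff /(_ k)[d d0 Hd] : forall j, exists2 d, 0 < d & forall A, F A -> (f A < j)%N -> Q A d.
  by exists d => // A FA; exact: Hd (fk A FA).
elim=> [|j [d d0 Hd]]; first by exists 1.
have [[A FA fA]|nA] := pselect (exists2 A, F A & f A = j).
  have [d' d'0 Hd'] := H A FA.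
  exists (Num.min d d'); first by rewrite lt_min d0.
  have m0 : 0 < Num.min d d' by rewrite lt_min d0.
  move=> B FB; rewrite ltnS leq_eqVlt => /orP[/eqP fB|fB].
    have -> : B = A by apply: finj; rewrite ?inE// fA.
    by apply: mono Hd'; rewrite m0 ge_min lexx orbT.
  by apply: mono (Hd B FB fB); rewrite m0 ge_min lexx.
exists d => // B FB; rewrite ltnS leq_eqVlt => /orP[/eqP fB|]; last exact: Hd.
by case: nA; exists B.
Qed.

Variables (k : nat) (rho : R) (F : set (set (R[i]^o * R[i]^o))).
Hypothesis Fcard : F #<= `I_k.
Hypothesis Fsub : F `<=` @vertical_lines R `|` holomorphic_graphs rho.
Hypothesis Ftriv : trivIset (F `&` holomorphic_graphs rho) id.

Let local_agree g h z : holomorphic_on_disk rho g -> holomorphic_on_disk rho h ->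
  graph_on_disk rho g `<=` \bigcup_(A in F) A -> F (graph_on_disk rho h) ->
  disk rho z -> g z = h z ->
  exists2 d : R, 0 < d & forall w, cabs (w - z) < d -> disk rho w -> g w = h w.
Proof.
move=> gh hh gF Fh zr ghz.
pose Q (A : set (R[i]^o * R[i]^o)) (d : R) :=
  forall w, cabs (w - z) < d -> w != z -> disk rho w -> A (w, g w) -> g w = h w.
have [d d0 Hd] : exists2 d, 0 < d & forall A, F A -> Q A d.
  apply: uniform_radius Fcard _ _ => [A d d' /andP[_ dd'] QA w wd|A FA].
    by apply: QA; exact: lt_le_trans dd'.
  case: (Fsub FA) => [[c _ <-]|[u uh uE]].
    have [cz|cz] := eqVneq c z.
      by exists 1 => // w _ wz _ E; have {}E : w = c := E; rewrite E cz eqxx in wz.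
    exists (cabs (c - z)); first by rewrite cabs_gt0 subr_eq0.
    by move=> w wd _ _ E; have {}E : w = c := E; rewrite E ltxx in wd.
  have [AE|AN] := pselect (A = graph_on_disk rho h).
    by exists 1 => // w _ _ _; rewrite AE => -[].
  have uz : u z != g z.
    apply/eqP => uzE; apply: AN.
    apply: (Ftriv (i := A) (j := graph_on_disk rho h)).
    - by split => //; exists u.
    - by split => //; exists h.
    - by exists (z, g z); rewrite -uE.
  have e0 : 0 < cabs (u z - g z) by rewrite cabs_gt0 subr_eq0.
  have c := ccontinuousB (derivable_continuous (uh z zr)) (derivable_continuous (gh z zr)).
  have [d d0 Hd] := (ccontinuousP _ _).1 c _ e0.
  exists d => // w /Hd + _ _; rewrite -uE => + [_ E]; have {}E : g w = u w := E.
  by rewrite E subrr sub0r cabsN ltxx.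
exists d => // w wd wr; have [->//|wz] := eqVneq w z.
have [A FA Aw] := gF (w, g w) (conj wr erefl).
exact: Hd Aw.
Qed.

(** A function whose graph is covered by the family agrees with a member h
   everywhere or nowhere: as the other members avoid the graph of h, the set of
   agreement is open. *)
Lemma graphs_agree g h z w : holomorphic_on_disk rho g -> holomorphic_on_disk rho h ->
  graph_on_disk rho g `<=` \bigcup_(A in F) A -> F (graph_on_disk rho h) ->
  disk rho z -> disk rho w -> g z = h z -> g w = h w.
Proof.
move=> gh hh gF Fh zr wr ghz; apply: contrapT => ghw.
pose p (s : R) := z + s%:C * (w - z).
have pr s : 0 <= s <= 1 -> disk rho (p s).
  move=> /andP[s0 s1]; apply/diskE.
  rewrite /p (_ : _ + _ = (1 - s)%:C * z + s%:C * w); last by rewrite rmorphB; ring.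
  rewrite (le_lt_trans (cabsD _ _))// !cabsM !cabsR !ger0_norm ?subr_ge0//.
  move/diskE : zr => zr; move/diskE : wr => wr.
  pose m := Num.max (cabs z) (cabs w).
  have mr : m < rho by rewrite gt_max zr.
  have [mz mw] : 0 <= m - cabs z /\ 0 <= m - cabs w.
    by rewrite !subr_ge0 !le_max !lexx orbT.
  have := mulr_ge0 s0 mw; have s1' : 0 <= 1 - s by rewrite subr_ge0.
  have := mulr_ge0 s1' mz; lra.
have pd s u : cabs (p s - p u) = `|s - u| * cabs (w - z).
  by rewrite -cabsR -cabsM; congr cabs; rewrite /p rmorphB; ring.
pose B := [set s : R | 0 <= s <= 1 /\ g (p s) <> h (p s)].
have B1 : B 1 by split; [rewrite lexx ler01|rewrite /p mul1r addrC subrK].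
have Blb : lbound B 0 by move=> s [/andP[]].
have Binf : has_inf B by split; [exists 1|exists 0].
pose b := inf B.
have b0 : 0 <= b by apply: lb_le_inf => //; exists 1.
have b1 : b <= 1 by apply: ge_inf => //; exists 0.
have bI : 0 <= b <= 1 by rewrite b0.
pose D := cabs (w - z) + 1.
have D0 : 0 < D by rewrite ltr_wpDl ?cabs_ge0.
have near (d s : R) : `|s - b| < d / D -> cabs (p s - p b) < d.
  rewrite ltr_pdivlMr// pd; apply: le_lt_trans; rewrite ler_wpM2l//.
  by rewrite lerDl.
have [ghb|ghb] := pselect (g (p b) = h (p b)).
  have [d d0 Hd] := local_agree gh hh gF Fh (pr b bI) ghb.
  have dD : 0 < d / D by rewrite divr_gt0.
  have [s [sI ghs] sb] := inf_adherent dD Binf.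
  have bs : b <= s by apply: ge_inf; [exists 0|split].
  apply: ghs; apply: Hd (pr s sI); apply: near.
  by rewrite ger0_norm ?subr_ge0// ltrBlDl.
have bpos : 0 < b.
  rewrite lt_def b0 andbT; apply/eqP => bE; apply: ghb.
  by rewrite bE /p mul0r addr0.
have e0 : 0 < cabs (g (p b) - h (p b)) by rewrite cabs_gt0 subr_eq0; apply/eqP.
have c := ccontinuousB (derivable_continuous (gh _ (pr b bI))) (derivable_continuous (hh _ (pr b bI))).
have [d d0 Hd] := (ccontinuousP _ _).1 c _ e0.
pose s := b - Num.min b (d / D) / 2.
have m0 : 0 < Num.min b (d / D) by rewrite lt_min bpos divr_gt0.
have mb : Num.min b (d / D) <= b by rewrite ge_min lexx.
have mD : Num.min b (d / D) <= d / D by rewrite ge_min lexx orbT.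
have sI : 0 <= s <= 1 by rewrite /s; apply/andP; split; lra.
have : s < b by rewrite /s; lra.
apply/negP; rewrite -leNgt; apply: ge_inf; first by exists 0.
split => // E.
have : cabs (p s - p b) < d.
  by apply: near; rewrite ler0_norm; rewrite /s; lra.
by move=> /Hd; rewrite E subrr sub0r cabsN ltxx.
Qed.

End Graphs.

(** * The uniform estimate *)

Section UniformEstimate.
Variable R : realType.
Implicit Types (S : {poly {poly R[i]}}) (z w : R[i]^o) (f : R[i]^o -> R[i]^o).

Lemma circle_stays_below f (r a b : R) z w : 0 < r -> a <= b ->
  (forall z, cabs z = r -> {for z, continuous f}) ->
  (forall z, cabs z = r -> ~ a <= cabs (f z) <= b) ->
  cabs z = r -> cabs w = r -> cabs (f z) < a -> cabs (f w) < a.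
Proof.
move=> r0 ab fc gap /(circle_param r0)[s _ ->] /(circle_param r0)[u _ ->] fz.
rewrite ltNge; apply/negP => fw; have c := continuous_circ (ltW r0) fc.
have gapc v : cabs (f (circ r v)) <> a.
  by move=> E; apply: (gap (circ r v) (cabs_circ v (ltW r0))); rewrite E lexx.
have [su|us] := leP s u.
  have [v _ E] : exists2 v, v \in `[s, u]%R & cabs (f (circ r v)) = a.
    apply: (IVT su); first exact: continuous_subspaceT.
    by rewrite ge_min le_max (ltW fz) fw orbT.
  exact: gapc E.
have [v _ E] : exists2 v, v \in `[u, s]%R & cabs (f (circ r v)) = a.
  apply: (IVT (ltW us)); first exact: continuous_subspaceT.
  by rewrite ge_min le_max (ltW fz) fw orbT.
exact: gapc E.
Qed.

Lemma coef_fiber S z j : (S.[z%:P])`_j = ((swapXY S)`_j).[z].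
Proof.
by rewrite -{1}(swapXYK S) horner_swapXY coef_map.
Qed.

Lemma size_coef_swap S k j : total_degree_le k S -> (size ((swapXY S)`_j)%R <= k.+1)%N.
Proof.
move=> Sk; apply/leq_sizeP => i ki; rewrite coef_swapXY; apply/eqP/negPn/negP => /Sk.
by rewrite leqNgt (leq_trans ki)// leq_addr.
Qed.

Lemma size_fiber S k z : total_degree_le k S -> (size S.[z%:P] <= k.+1)%N.
Proof.
move=> Sk; apply/leq_sizeP => j kj; rewrite coef_fiber.
rewrite (_ : (swapXY S)`_j = 0) ?horner0//; apply/polyP => i.
rewrite coef_swapXY coef0; apply/eqP/negPn/negP => /Sk.
by rewrite leqNgt (leq_trans kj)// leq_addl.
Qed.

Lemma exists_coef_swap S k : S != 0 -> total_degree_le k S ->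
  exists2 j, (j <= k)%N & 0 < wnorm 1 (swapXY S)`_j.
Proof.
move=> S0 Sk; pose i := (size S).-1; pose j := (size S`_i).-1.
have Si : S`_i != 0 by rewrite -lead_coefE lead_coef_eq0.
have Sij : S`_i`_j != 0 by rewrite -lead_coefE lead_coef_eq0.
exists j; first by rewrite (leq_trans _ (Sk _ _ Sij))// leq_addl.
rewrite lt_def wnorm_eq0 wnorm_ge0// andbT; apply: contraNneq Sij => E.
by rewrite -coef_swapXY E coef0.
Qed.

(** At the given points the part of S free of w is minus the sum of the other
   terms. *)
Lemma free_part_bound S k (x : 'I_k.+1 -> R[i]) (c P t : R) f :
  total_degree_le k S -> 0 <= c -> 1 <= P -> 0 <= t ->
  (forall (s : {poly R[i]}) (B : R), (size s <= k.+1)%N -> (forall l, cabs s.[x l] <= B) -> wnorm 1 s <= c * B) ->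
  (forall l, [/\ cabs (x l) <= P, cabs (f (x l)) <= t & S.[x l, f (x l)] = 0]) ->
  wnorm 1 (swapXY S)`_0 <=
    c * (P ^+ k * \sum_(j < k) wnorm 1 (swapXY S)`_j.+1 * t ^+ j.+1).
Proof.
move=> Sk c0 P1 t0 cP fx; apply: cP; first exact: size_coef_swap.
move=> l; have [xP ft E] := fx l.
move: E; rewrite (horner_coef_wide _ (size_fiber (x l) Sk)) big_ord_recl.
rewrite expr0 mulr1 coef_fiber => /eqP; rewrite addr_eq0 => /eqP ->.
rewrite cabsN (le_trans (cabs_sum _ _ _))// mulr_sumr ler_sum// => j _.
rewrite cabsM cabsX coef_fiber mulrA; apply: ler_pM; rewrite ?cabs_ge0 ?exprn_ge0 ?cabs_ge0//.
  by apply: horner_le_pow => //; exact: size_coef_swap.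
by rewrite lerXn2r ?nnegrE ?cabs_ge0.
Qed.

(** The dichotomy on the circle of radius r described at the beginning; the factor
   L makes every comparison of [no_root_annulus] and [small_root] strict, and rules
   out q = 0. *)
Theorem uniform_estimate (k : nat) (x : 'I_k.+1 -> R[i]) (rmin P m : R) :
  injective x -> 0 < rmin -> 1 <= P -> 1 < m ->
  exists2 C : R, 0 <= C & forall rho : R, rmin <= rho <= P ->
    forall g t0, classV0 k rho g -> 0 < t0 ->
    (forall l, cabs (x l) < rho /\ cabs (g (x l)) <= t0) ->
    forall j, cabs (taylor_coef g j) <= C * t0 * (m / rho) ^+ j.
Proof.
move=> xinj rmin0 P1 m1.
have [c1 c10 Hc1] := interpolation_bound xinj.
have m0 : 0 < m by lra.
pose del := rmin * (1 - m^-1).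
have minv : m^-1 < 1 by rewrite invf_lt1.
have del0 : 0 < del by rewrite mulr_gt0// subr_gt0.
have [c3 c30 Hc3] := good_circle k del0 P1.
have Pk0 : 0 < P ^+ k by rewrite exprn_gt0//; lra.
pose X1 := c1 * P ^+ k * k%:R; pose X2 := k.+1%:R * 6 ^+ k * P ^+ k / c3.
have X10 : 0 <= X1 by rewrite /X1 !mulr_ge0// ltW.
have X20 : 0 <= X2 by rewrite /X2 divr_ge0 ?(ltW c30)// !mulr_ge0 ?exprn_ge0// ltW// (lt_le_trans ltr01).
pose L := 2 + X1 + X2.
have [L1 LX1 LX2 L0] : [/\ 1 < L, X1 < L, X2 < L & 0 < L] by rewrite /L; split; lra.
exists (L ^+ (2 * k + 1)); first by rewrite exprn_ge0// ltW.
move=> rho /andP[rminrho rhoP] g t0 [[gh [S [S0 Sk gS [F [Fcard Fsub Ftriv FE]]]]] g0] t00 gx.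
have rho0 : 0 < rho by exact: lt_le_trans rminrho.
pose T j := (swapXY S)`_j; pose sg j := wnorm 1 (T j).
have sg0 j : 0 <= sg j by exact: wnorm_ge0.
have Tk j : (size (T j) <= k.+1)%N by exact: size_coef_swap.
have [t [q [/andP[t0t tL] qk sgq dom]]] := dominant_scale sg0 L1 t00 (exists_coef_swap S0 Sk).
have tpos : 0 < t by exact: lt_le_trans t0t.
have inS z w : disk rho z -> (\bigcup_(A in F) A) (z, w) -> S.[z, w] = 0.
  by move=> zr; rewrite -FE => -[].
have inF z w : disk rho z -> S.[z, w] = 0 -> (\bigcup_(A in F) A) (z, w).
  by move=> zr E; rewrite -FE; split.
have gSz z : disk rho z -> S.[z, g z] = 0 by move=> zr; apply: (gS (z, g z)).
have q0 : q != 0%N.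
  apply/eqP => qE; rewrite qE in sgq dom.
  have := @free_part_bound S k x c1 P t g Sk c10 P1 (ltW tpos) Hc1.
  have fx l : [/\ cabs (x l) <= P, cabs (g (x l)) <= t & S.[x l, g (x l)] = 0].
    have [xr gt0] := gx l; split.
    - by rewrite ltW// (lt_le_trans xr).
    - exact: le_trans t0t.
    - by apply: gSz; apply/diskE.
  move=> /(_ fx); rewrite -/(sg 0%N) => le1.
  have : L * sg 0%N <= X1 * sg 0%N.
    rewrite (le_trans (ler_wpM2l (ltW L0) le1))//.
    rewrite (_ : L * _ = c1 * P ^+ k * (\sum_(j < k) L * (sg j.+1 * t ^+ j.+1))); last first.
      by rewrite -mulr_sumr; ring.
    rewrite /X1 -[leRHS]mulrA ler_wpM2l ?mulr_ge0 ?(ltW Pk0)//.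
    rewrite (le_trans (ler_sum _ (G := fun=> sg 0%N) _))//.
      by move=> j _; rewrite (le_trans (dom _ _ _))// expr0 mulr1.
    by rewrite sumr_const card_ord mulr_natl.
  by rewrite leNgt ltr_pM2r// LX1.
have [||r /andP[rm rrho] Hr] := Hc3 (T q) (rho / m) rho (Tk q) _ rhoP.
- by rewrite divr_ge0// ltW.
- rewrite (_ : rho - rho / m = rho * (1 - m^-1)); last by ring.
  by rewrite ler_wpM2r// subr_ge0 ltW.
have r0 : 0 < r by rewrite (le_lt_trans _ rm)// divr_ge0 ?ltW.
have rdisk z : cabs z = r -> disk rho z by move=> zr; apply/diskE; rewrite zr.
pose e := P ^+ k / (L * c3).
have e0 : 0 < e by rewrite divr_gt0// mulr_gt0.
have ke : k.+1%:R * 6 ^+ k * e < 1.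
  rewrite (_ : _ * e = X2 / L); last by rewrite /X2 /e; field; rewrite !gt_eqF.
  by rewrite ltr_pdivrMr// mul1r.
have Tq z : cabs z = r -> 0 < cabs (T q).[z].
  by move=> zr; rewrite (lt_le_trans _ (Hr z zr))// mulr_gt0.
have circ_dom z i : cabs z = r -> (i <= k)%N -> i != q ->
    cabs (T i).[z] * t ^+ i <= e * (cabs (T q).[z] * t ^+ q).
  move=> zr ik iq.
  have zP : cabs z <= P by rewrite zr ltW// (lt_le_trans rrho).
  have h1 := horner_le_pow (Tk i) zP P1.
  have ti m' : 0 <= t ^+ m' by rewrite exprn_ge0// ltW.
  rewrite (le_trans (ler_wpM2r (ti i) h1))// -mulrA -/(sg i).
  have h2 : sg i * t ^+ i <= sg q * t ^+ q / L by rewrite ler_pdivlMr// mulrC dom.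
  rewrite (le_trans (ler_wpM2l (ltW Pk0) h2))//.
  rewrite (_ : P ^+ k * _ = e * (c3 * sg q * t ^+ q)); last first.
    by rewrite /e; field; rewrite !gt_eqF.
  by rewrite ler_wpM2l ?(ltW e0)// ler_wpM2r// Hr.
have noroot z w : cabs z = r -> t <= cabs w <= 3 * t -> S.[z, w] != 0.
  move=> zr wt.
  apply: (@no_root_annulus R S.[z%:P] t e k q w (size_fiber z Sk) tpos (ltW e0) qk) => //.
  - by rewrite coef_fiber -cabs_gt0 Tq.
  - by move=> i ik iq; rewrite !coef_fiber circ_dom.
  - rewrite (le_lt_trans _ ke)// ler_wpM2r ?(ltW e0)// ler_wpM2l//.
    by rewrite lerXn2r// ?nnegrE// ler_nat.
pose z0 : R[i]^o := r%:C.
have z0r : cabs z0 = r by rewrite cabsR ger0_norm// ltW.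
have [w0 w0t rw0] : exists2 w, cabs w < t & root S.[z0%:P] w.
  apply: (@small_root R _ t k q (size_fiber z0 Sk) tpos).
  rewrite !coef_fiber; have := circ_dom z0 0%N z0r (leq0n _) (ltac:(by rewrite eq_sym)).
  rewrite expr0 mulr1 => h.
  rewrite (le_lt_trans (ler_wpM2l _ h)) ?exprn_ge0// -/(T q).
  rewrite (mulrA _ e) gtr_pMl; last by rewrite mulr_gt0 ?Tq// exprn_gt0.
  rewrite (le_lt_trans _ ke)// ler_wpM2r ?(ltW e0)//.
  rewrite (le_trans (_ : _ <= 6 ^+ k))//; first by rewrite lerXn2r// ?nnegrE// ler_nat.
  by rewrite ler_peMl ?exprn_ge0// ler1n.
have [A FA Aw] := inF z0 w0 (rdisk z0 z0r) (eqP rw0).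
case: (Fsub A FA) => [[c _ cA]|[h hh hA]].
  exfalso; have : S.[z0, t%:C] = 0.
    apply: inS; first exact: rdisk.
    by exists A => //; move: Aw; rewrite -cA.
  move/eqP; apply/negP; apply: noroot => //.
  by rewrite cabsR ger0_norm ?(ltW tpos)// lexx /= ler_peMl ?ler1n// ltW.
have Fh : F (graph_on_disk rho h) by rewrite hA.
have hz0 : h z0 = w0 by move: Aw; rewrite -hA => -[_ E]; symmetry; exact: E.
have gapg z : cabs z = r -> ~ t <= cabs (g z) <= 3 * t.
  by move=> zr /(noroot z _ zr)/eqP; apply; apply: gSz; exact: rdisk.
have gaph z : cabs z = r -> ~ t <= cabs (h z) <= 3 * t.
  move=> zr /(noroot z _ zr)/eqP; apply; apply: inS; first exact: rdisk.
  by exists (graph_on_disk rho h) => //; split => //; exact: rdisk.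
have cont u z : holomorphic_on_disk rho u -> cabs z = r -> {for z, continuous u}.
  by move=> uh zr; exact: (derivable_continuous (uh z (rdisk z zr))).
have t3 : t <= 3 * t by rewrite ler_peMl ?ler1n// ltW.
have hsmall z : cabs z = r -> cabs (h z) < t.
  move=> zr; apply: (circle_stays_below r0 t3 (fun z => @cont h z hh) gaph z0r zr).
  by rewrite hz0.
have [gz0|gz0] := ltP (cabs (g z0)) t.
  have gsmall z : cabs z = r -> cabs (g z) <= t.
    move=> zr; apply: ltW.
    exact: (circle_stays_below r0 t3 (fun z => @cont g z gh) gapg z0r zr).
  move=> j; rewrite (le_trans (cauchy_estimate j r0 rrho gh gsmall))//.
  apply: ler_pM; rewrite ?(ltW tpos) ?invr_ge0 ?exprn_ge0 ?(ltW r0)//.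
    by rewrite mulrC.
  rewrite -exprVn lerXn2r ?nnegrE ?invr_ge0 ?(ltW r0) ?divr_ge0 ?(ltW m0) ?(ltW rho0)//.
  by rewrite -[m / rho]invf_div lef_pV2 ?posrE ?divr_gt0// ltW.
(* Otherwise g is large and h is small on the circle, while |g - h| is at most
   t at the origin, against the minimum principle for the zero-free g - h. *)
exfalso.
have gbig z : cabs z = r -> 3 * t <= cabs (g z).
  move=> zr; rewrite leNgt; apply/negP => gz.
  have gzt : cabs (g z) < t.
    by rewrite ltNge; apply/negP => h1; apply: (gapg z zr); rewrite h1 ltW.
  have := circle_stays_below r0 t3 (fun z => @cont g z gh) gapg zr z0r gzt.
  by rewrite ltNge gz0.
have ghz z : disk rho z -> g z - h z != 0.
  move=> zr; rewrite subr_eq0; apply/eqP => E.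
  have := graphs_agree Fcard Fsub Ftriv gh hh _ Fh zr (rdisk z0 z0r) E.
  move=> /(_ _)/(congr1 (@cabs R)) E0.
  have := gbig z0 z0r; rewrite E0; last first.
    by move=> [u v] [ur /= ->]; apply: inF => //; exact: gSz.
  move: (hsmall z0 z0r) tpos; clear; lra.
have phih : holomorphic_on_disk rho (fun z => (g z - h z)^-1 : R[i]^o).
  by move=> z zr; exact (cderivableV (cderivableB (gh z zr) (hh z zr)) (ghz z zr)).
have d0 : disk rho 0 by apply/diskE; rewrite cabs0.
have phiB z : cabs z = r -> cabs (g z - h z)^-1 <= (2 * t)^-1.
  move=> zr; have := hsmall z zr; have := gbig z zr; have := cabs_sub_ge (g z) (h z).
  move=> h1 h2 h3; rewrite cabsV lef_pV2 ?posrE ?mulr_gt0// ?cabs_gt0 ?ghz//; last exact: rdisk.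
  by move: h1 h2 h3; clear; lra.
have := cauchy_estimate 0 r0 rrho phih phiB.
rewrite taylor_coef0 expr0 divr1 cabsV lef_pV2 ?posrE ?mulr_gt0// ?cabs_gt0 ?ghz//.
rewrite g0 sub0r cabsN => h1.
have := cauchy_estimate 0 r0 rrho hh (fun z zr => ltW (hsmall z zr)).
rewrite taylor_coef0 expr0 divr1; move: h1 tpos; clear; lra.
Qed.

(** [uniform_estimate] needs a positive bound t0; this covers M = 0. *)
Lemma le_of_all_larger (a A M : R) : 0 <= A -> 0 <= M ->
  (forall t, 0 < t -> M <= t -> a <= A * t) -> a <= A * M.
Proof.
move=> A0 M0 H; apply/ler_addgt0Pr => e e0.
have A1 : 0 < A + 1 by lra.
have d0 : 0 < e / (A + 1) by rewrite divr_gt0.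
have := H (M + e / (A + 1)) _ _; rewrite mulrDr => h.
rewrite (le_trans (h _ _))//; [lra|lra|].
by rewrite lerD2l mulrCA ler_piMr ?(ltW e0)// ler_pdivrMr// mul1r; lra.
Qed.

End UniformEstimate.

Lemma classV_degree0 (R : realType) (rho : R) (f : R[i]^o -> R[i]^o) :
  0 < rho -> ~ classV 0 rho f.
Proof.
move=> rho0 [_ [S [_ _ gS [F [F0 _ _ FE]]]]].
have d0 : disk rho 0 by apply/diskE; rewrite cabs0.
have : (zero_locus S `&` (disk rho `*` setT)) (0, f 0) by split => //; exact: gS.
rewrite FE => -[A FA _].
by move: F0; rewrite II0 card_le0 => /eqP F0; rewrite F0 in FA.
Qed.

Theorem theorem2p2 (R : realType) (k : nat) (K : set R[i]^o)
    (Kcompact : compact K) (Kcard : `I_k.+1 #<= K) :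
  (forall rho : R, 1 < rho -> K `<=` disk rho ->
    exists C : R, forall M : R, 0 <= M ->
      forall g : R[i]^o -> R[i]^o, classU k rho K M g ->
      forall j : nat, (1 <= j)%N ->
        `|taylor_coef g j| <= (C * M)%:C)
  /\
  (forall m : R, 1 < m ->
    exists C : R, forall rho : R, 0 < rho -> rho <= 1 -> K `<=` disk rho ->
      forall M : R, 0 <= M ->
      forall g : R[i]^o -> R[i]^o, classU k rho K M g ->
      forall j : nat, (1 <= j)%N ->
        `|taylor_coef g j| <= (C * M * (m / rho) ^+ j)%:C).
Proof.
have [x xinj xK] : exists2 x : 'I_k.+1 -> R[i], injective x & forall l, K (x l).
  move: Kcard => /pcard_leP/unsquash f; exists (fun l : 'I_k.+1 => f l).
    by move=> i j /(inj (f := f)) E; apply: val_inj; apply: E; rewrite inE /=.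
  by move=> l; apply: funS => /=.
have bound (rho M : R) g t : K `<=` disk rho -> classU k rho K M g -> M <= t ->
    forall l, cabs (x l) < rho /\ cabs (g (x l)) <= t.
  move=> Krho [_ [gM _]] Mt l; split; first by apply/diskE; exact: Krho.
  by rewrite (le_trans _ Mt)// -cabsC_le; exact: gM.
split=> [rho rho1 Krho|m m1].
  have [C C0 HC] := uniform_estimate xinj (lt_trans ltr01 rho1) (ltW rho1) rho1.
  exists C => M M0 g gU j _; rewrite cabsC_le.
  apply: le_of_all_larger => // t t0 Mt.
  have [gV _] := gU.
  have := HC rho _ g t gV t0 (bound _ _ _ _ Krho gU Mt) j.
  rewrite !lexx divff ?expr1n ?mulr1; last by rewrite gt_eqF// (lt_trans ltr01).
  exact.
have [k0|k0] := posnP k.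
  subst k; exists 0 => rho rho0 _ _ M _ g [[gV _] _].
  by have := classV_degree0 rho0 gV.
(* Two of the points are distinct, hence rho is bounded below independently of g. *)
pose l1 : 'I_k.+1 := Ordinal (k0 : (1 < k.+1)%N).
pose rmin := Num.max (cabs (x ord0)) (cabs (x l1)).
have rmin0 : 0 < rmin.
  rewrite lt_max !cabs_gt0 -negb_and; apply/negP => /andP[/eqP x0 /eqP x1].
  by have /(congr1 val) : ord0 = l1 by apply: xinj; rewrite x0 x1.
have [C C0 HC] := uniform_estimate xinj rmin0 (lexx 1) m1.
exists C => rho rho0 rho1 Krho M M0 g gU j _; rewrite cabsC_le.
have mr : 0 <= (m / rho) ^+ j.
  by rewrite exprn_ge0// divr_ge0 ?(ltW rho0)// ltW// (lt_trans ltr01).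
rewrite mulrAC; apply: le_of_all_larger => // [|t t0 Mt]; first exact: mulr_ge0.
have [gV _] := gU; have xt := bound _ _ _ _ Krho gU Mt.
rewrite mulrAC; apply: HC => //; rewrite rho1 andbT ge_max.
by rewrite !ltW//; [case: (xt l1)|case: (xt ord0)].
Qed.
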